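(* Let $x=(x_1,x_2,\dots)$ and $y=(y_1,y_2,\dots)$ be two sets of independent variables. Then, as formal power series in $x$ and $y$, \[ \sum_{\lambda,\mu} q^{n(\lambda)+n(\mu)-\langle\lambda',\mu'\rangle} P_{\lambda}(x;q)P_{\mu}(y;q) =\prod_{i\geq 1}\frac{1}{(1-x_i)(1-y_i)}\prod_{i,j\geq 1}\frac{1-x_iy_j}{1-q^{-1}x_iy_j}, \] where the sum is over all pairs of partitions $\lambda,\mu$.
   Context: Partitions $\lambda=(\lambda_1\geq\lambda_2\geq\dots)$ have finitely many nonzero parts; $\lambda'$ is the conjugate partition, $\ell(\lambda)$ the number of nonzero parts, $|\lambda|$ the sum of parts, $m_i(\lambda)$ the multiplicity of $i$ as a part. $n(\lambda)=\sum_{i\geq1}(i-1)\lambda_i=\sum_i\binom{\lambda_i'}{2}$ and $\langle\lambda,\mu\rangle=\sum_{i\geq1}\lambda_i\mu_i$. For $x=(x_1,\dots,x_n)$ and $\ell(\lambda)\le n$ the Hall–Littlewood polynomial is $P_\lambda(x;q)=\sum_{w\in S_n/S_n^\lambda} w\bigl(x^\lambda\prod_{i<j:\,\lambda_i>\lambda_j}\frac{x_i-qx_j}{x_i-x_j}\bigr)$, where $S_n^\lambda$ is the stabilizer of $\lambda$ and $w$ permutes the variables; $P_\lambda(x;q)=0$ if $\ell(\lambda)>n$. By stability under setting $x_{n+1}=0$ these define the Hall–Littlewood symmetric functions $P_\lambda(x;q)$ in infinitely many variables. *)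

(* Defs.v *)
From HB Require Import structures.
From mathcomp Require Import all_boot all_order all_algebra all_fingroup.
From mathcomp Require Import finmap boolp classical_sets functions cardinality.
From mathcomp Require Import fsbigop.
From mathcomp Require Import monalg mpoly.

Set Implicit Arguments.
Unset Strict Implicit.
Unset Printing Implicit Defensive.

Import Order.TTheory GRing.Theory.

Local Open Scope classical_set_scope.
Local Open Scope ring_scope.

(* Both monalg and mpoly declare this notation; it is mpoly's that is meant. *)
Notation "{ 'mpoly' T [ n ] }" := (mpoly n T) : type_scope.

(* -------------------------------------------------------------------- *)
(* Formal power series over K in a possibly infinite family of variables
   indexed by I: arbitrary K-valued functions on the finitely supported
   exponent vectors {cmonom I}, with the Cauchy product. *)

Record fps (I : choiceType) (K : Type) : Type :=
  Fps { coef : {cmonom I} -> K }.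

Arguments Fps {I K} coef.
Arguments coef {I K} f m : rename.

HB.instance Definition _ (I : choiceType) (K : Type) :=
  gen_eqMixin (fps I K).
HB.instance Definition _ (I : choiceType) (K : Type) :=
  gen_choiceMixin (fps I K).

Lemma fpsP (I : choiceType) (K : Type) (f g : fps I K) :
  coef f =1 coef g -> f = g.
Proof. by case: f g => [f] [g] /= /funext->. Qed.

Lemma cmonom_divisors (I : choiceType) (m : {cmonom I}) :
  exists D : {fset {cmonom I}}, forall a b, mmul a b = m -> a \in D /\ b \in D.
Proof.
pose T := {ffun finsupp m -> 'I_(monalg.mdeg m).+1}.
pose h (g : T) : {cmonom I} :=
  ([cmonom (if insub i is Some j then g j : nat else 0%N) | i in finsupp m])%M.
pose D := [fset h g | g : T]%fset.
have inD (a : {cmonom I}) : (forall i, (a i <= m i)%N) -> a \in D.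
  move=> le_am; apply/imfsetP => /=.
  exists [ffun j : finsupp m => inord (a (val j))] => //.
  apply/eqP/cmP => i; rewrite cmE fsfun_fun.
  case: ifPn => [im|im]; last first.
    by move: (le_am i); rewrite (fsfun_dflt im) leqn0 => /eqP.
  rewrite insubT /= ffunE /= inordK // ltnS (leq_trans (le_am i)) //.
  by rewrite monalg.mdegE (big_fsetD1 i) //= leq_addr.
exists D => a b abm; split; apply: inD => i; rewrite -abm cmM ?leq_addr ?leq_addl //.
Qed.

Section FpsRing.
Context (I : choiceType) (K : comNzRingType).
Implicit Types (f g h : fps I K) (m : {cmonom I}) (D : {fset {cmonom I}}).

Definition fps_zero : fps I K := Fps (fun=> 0).
Definition fps_opp f : fps I K := Fps (fun m => - coef f m).
Definition fps_add f g : fps I K := Fps (fun m => coef f m + coef g m).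

Fact fps_addA : associative fps_add.
Proof. by move=> f g h; apply: fpsP => m /=; rewrite addrA. Qed.
Fact fps_addC : commutative fps_add.
Proof. by move=> f g; apply: fpsP => m /=; rewrite addrC. Qed.
Fact fps_add0 : left_id fps_zero fps_add.
Proof. by move=> f; apply: fpsP => m /=; rewrite add0r. Qed.
Fact fps_addN : left_inverse fps_zero fps_opp fps_add.
Proof. by move=> f; apply: fpsP => m /=; rewrite addNr. Qed.

HB.instance Definition _ :=
  GRing.isZmodule.Build (fps I K) fps_addA fps_addC fps_add0 fps_addN.

Definition fps_one : fps I K := Fps (fun m => (m == mone)%:R).
Definition fps_mul f g : fps I K :=
  Fps (fun m => \sum_(p \in [set p : {cmonom I} * {cmonom I} |
                               mmul p.1 p.2 = m]) coef f p.1 * coef g p.2).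

Lemma fps_mulE D m : (forall a b, mmul a b = m -> a \in D /\ b \in D) ->
  forall f g, coef (fps_mul f g) m =
    \sum_(a <- D) \sum_(b <- D | mmul a b == m) coef f a * coef g b.
Proof.
move=> hD f g /=.
rewrite (@fsbigE _ _ _ _ _ ([seq p <- [seq (a, b) | a <- D, b <- D]
                          | mmul p.1 p.2 == m])) /=; last 3 first.
- by rewrite filter_uniq // allpairs_uniq ?fset_uniq //; move=> [? ?] [? ?].
- by move=> [a b] /=; rewrite mem_filter /= => /andP[/eqP].
- move=> [a b] /= abm; rewrite mem_filter /= abm eqxx /=.
  by have [aD bD] := hD _ _ abm; rewrite allpairs_f.
rewrite big_filter_cond /= (eq_bigl (fun p => mmul p.1 p.2 == m)); last first.
  move=> p; case: eqP => //= pm; apply/asboolP; exact: pm.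
rewrite big_mkcond big_allpairs /=; apply: eq_bigr => a _.
by rewrite [RHS]big_mkcond.
Qed.

Fact fps_mulC : commutative fps_mul.
Proof.
move=> f g; apply: fpsP => m; have [D hD] := cmonom_divisors m.
rewrite !(fps_mulE hD) (exchange_big_dep xpredT) //=; apply: eq_bigr => b _.
by apply: eq_big => [a|a _] /=; [rewrite mulmC | rewrite mulrC].
Qed.

Let big_pick D a (c : K) (P : pred {cmonom I}) : a \in D ->
  \sum_(d <- D) (if a == d then if P d then c else 0 else 0) = if P a then c else 0.
Proof.
move=> aD; rewrite (big_fsetD1 a) //= eqxx big1_seq ?addr0 // => d /andP[_].
by rewrite in_fsetD1 eq_sym => /andP[/negPf->].
Qed.

Fact fps_mul1 : left_id fps_one fps_mul.
Proof.
move=> f; apply: fpsP => m; have [D hD] := cmonom_divisors m.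
have [D1 Dm] := hD _ _ (mul1m m).
rewrite (fps_mulE hD) (big_fsetD1 mone) //=.
rewrite [X in _ + X]big1_seq ?addr0; last first.
  move=> a /andP[_]; rewrite in_fsetD1 => /andP[a1 _].
  by apply: big1 => b _; rewrite (negbTE a1) mul0r.
rewrite big_mkcond /= (big_fsetD1 m) //= mul1m !eqxx mul1r.
rewrite big1_seq ?addr0 // => b /andP[_].
by rewrite in_fsetD1 mul1m => /andP[/negPf->].
Qed.

Fact fps_mulDl : left_distributive fps_mul fps_add.
Proof.
move=> f g h; apply: fpsP => m; have [D hD] := cmonom_divisors m.
transitivity (coef (fps_mul f h) m + coef (fps_mul g h) m); last by [].
rewrite !(fps_mulE hD) -big_split /=.
apply: eq_bigr => a _; rewrite -big_split /=; apply: eq_bigr => b _.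
by rewrite mulrDl.
Qed.

Fact fps_mulA : associative fps_mul.
Proof.
suff main f g h m D : (forall a b, mmul a b = m -> a \in D /\ b \in D) ->
    coef (fps_mul (fps_mul f g) h) m =
    \sum_(a <- D) \sum_(b <- D) \sum_(c <- D)
      if mmul (mmul a b) c == m then coef f a * coef g b * coef h c else 0.
  move=> f g h; apply: fpsP => m; have [D hD] := cmonom_divisors m.
  rewrite fps_mulC (fps_mulC g) !(main _ _ _ _ D) //.
  rewrite exchange_big /=.
  under eq_bigr => b _ do rewrite exchange_big /=.
  rewrite exchange_big /=; apply: eq_bigr => a _.
  apply: eq_bigr => b _; apply: eq_bigr => c _.
  by rewrite mulmC (mulmC c) mulmA mulrC (mulrC (coef h c)) mulrA.
move=> hD.
have hDl d c : mmul d c = m -> forall a b, mmul a b = d -> a \in D /\ b \in D.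
  move=> dcm a b abd; split.
    by have [] := hD a (mmul b c); rewrite // mulmA abd.
  by have [] := hD b (mmul a c); rewrite // mulmA (mulmC b) abd.
rewrite (fps_mulE hD).
transitivity (\sum_(d <- D) \sum_(c <- D) \sum_(a <- D) \sum_(b <- D)
   if mmul a b == d then if mmul d c == m then coef f a * coef g b * coef h c else 0 else 0).
  apply: eq_bigr => d _; rewrite big_mkcond; apply: eq_bigr => c _.
  case: eqP => [dcm|_]; last first.
    by rewrite big1 // => a _; rewrite big1 // => b _; case: ifP.
  rewrite (fps_mulE (hDl _ _ dcm)) big_distrl /=.
  apply: eq_bigr => a _; rewrite big_distrl /= big_mkcond; apply: eq_bigr => b _.
  by [].
rewrite exchange_big /=.
under eq_bigr => c _ do rewrite exchange_big /=.
rewrite exchange_big /=; apply: eq_bigr => a _.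
under eq_bigr => c _ do rewrite exchange_big /=.
rewrite exchange_big /=; apply: eq_bigr => b _; apply: eq_bigr => c _.
have [abD|abD] := boolP (mmul a b \in D).
  exact: (big_pick _ (fun d => mmul d c == m)).
case: eqP => [abcm|_]; first by have [] := hD _ _ abcm; rewrite (negbTE abD).
rewrite big1_seq // => d /andP[_ dD]; case: eqP => // abd.
by rewrite abd dD in abD.
Qed.
Fact fps_oner_neq0 : fps_one != 0.
Proof.
by apply/eqP => /(congr1 (fun f => coef f mone)) /eqP; rewrite /= eqxx oner_eq0.
Qed.

HB.instance Definition _ := GRing.Zmodule_isComNzRing.Build (fps I K)
  fps_mulA fps_mulC fps_mul1 fps_mulDl fps_oner_neq0.

Definition fps_scale (c : K) f : fps I K := Fps (fun m => c * coef f m).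

Fact fps_scaleA a b f : fps_scale a (fps_scale b f) = fps_scale (a * b) f.
Proof. by apply: fpsP => m /=; rewrite mulrA. Qed.
Fact fps_scale1 : left_id 1 fps_scale.
Proof. by move=> f; apply: fpsP => m /=; rewrite mul1r. Qed.
Fact fps_scaleDr : right_distributive fps_scale +%R.
Proof. by move=> a f g; apply: fpsP => m /=; rewrite mulrDr. Qed.
Fact fps_scaleDl f : {morph fps_scale^~ f : a b / a + b}.
Proof. by move=> a b; apply: fpsP => m /=; rewrite mulrDl. Qed.

HB.instance Definition _ := GRing.Zmodule_isLmodule.Build K (fps I K)
  fps_scaleA fps_scale1 fps_scaleDr fps_scaleDl.

Fact fps_scaleAl (c : K) f g : c *: (f * g) = c *: f * g.
Proof.
apply: fpsP => m; have [D hD] := cmonom_divisors m.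
transitivity (c * coef (fps_mul f g) m); first by [].
rewrite -[RHS]/(coef (fps_mul (c *: f) g) m) !(fps_mulE hD) big_distrr /=; apply: eq_bigr => a _.
by rewrite big_distrr /=; apply: eq_bigr => b _; rewrite mulrA.
Qed.

HB.instance Definition _ :=
  GRing.Lmodule_isLalgebra.Build K (fps I K) fps_scaleAl.

(* A unit is a series having an inverse; the latter is unique, and series
   which have none are left unchanged by ^-1, as usual. *)
Definition fps_unit : {pred fps I K} := fun f => `[< exists g, g * f = 1 >].
Definition fps_inv f : fps I K := xget f [set g | g * f = 1].

Fact fps_mulVr : {in fps_unit, left_inverse 1 fps_inv *%R}.
Proof. by move=> f /asboolP; apply: (@xgetPex _ f [set g | g * f = 1]). Qed.
Fact fps_unitP f g : g * f = 1 -> f \in fps_unit.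
Proof. by move=> gf1; apply/asboolP; exists g. Qed.
Fact fps_inv_out : {in [predC fps_unit], fps_inv =1 id}.
Proof.
move=> f; rewrite inE => /asboolPn nf; apply: xgetPN => g gf1.
by apply: nf; exists g.
Qed.

HB.instance Definition _ := GRing.ComNzRing_hasMulInverse.Build (fps I K)
  fps_mulVr fps_unitP fps_inv_out.

Definition fps_var (i : I) : fps I K := Fps (fun m => (m == ucm i)%:R).

End FpsRing.

(* -------------------------------------------------------------------- *)
(* Infinite sums and products of formal power series over an arbitrary index
   set T: unconditional limits, along the finite subsets of T, for the
   topology of coefficientwise (eventually constant) convergence.  For sums
   this says that each coefficient is nonzero for finitely many t only. *)

Section Infinite.
Context (I T : choiceType) (K : comNzRingType).
Implicit Types (u : T -> fps I K) (s : fps I K).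

Definition fset_cvg (v : {fset T} -> fps I K) s : Prop :=
  forall m : {cmonom I}, exists A0 : {fset T},
    forall A : {fset T}, (A0 `<=` A)%fset -> coef (v A) m = coef s m.

Lemma fset_cvg_unique v s1 s2 : fset_cvg v s1 -> fset_cvg v s2 -> s1 = s2.
Proof.
move=> v1 v2; apply: fpsP => m; have [A1 h1] := v1 m; have [A2 h2] := v2 m.
by rewrite -(h1 (A1 `|` A2)%fset) ?fsubsetUl // -(h2 (A1 `|` A2)%fset) ?fsubsetUr.
Qed.

Definition has_sum u s := fset_cvg (fun A => \sum_(t <- A) u t) s.
Definition has_prod u s := fset_cvg (fun A => \prod_(t <- A) u t) s.

Definition summable u : Prop := exists s, has_sum u s.
Definition multipliable u : Prop := exists s, has_prod u s.

(* Meaningful when u is summable, resp. multipliable; by fset_cvg_unique the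
   choice is then forced. *)
Definition infsum u : fps I K := xget 0 [set s | has_sum u s].
Definition infprod u : fps I K := xget 1 [set s | has_prod u s].

End Infinite.

(* Substitution of the variable v i for the variable i, for v injective. *)
Definition cmonom_map (I J : choiceType) (v : I -> J) (m : {cmonom I}) :
    {cmonom J} :=
  \big[mmul/mone]_(i <- finsupp m) expcmn (ucm (v i)) (m i).

Definition fps_rename (I J : choiceType) (K : comNzRingType) (v : I -> J)
    (f : fps I K) : fps J K :=
  Fps (fun m => \sum_(m' \in [set m' | cmonom_map v m' = m]) coef f m').

(* -------------------------------------------------------------------- *)
(* Partitions, as the weakly decreasing lists of their nonzero parts.  Parts
   are indexed from 0: nth 0 la i is the part usually written la_(i+1). *)

Definition is_intpart (s : seq nat) : bool := sorted geq s && (0%N \notin s).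

Record intpart := IntPart { parts :> seq nat; _ : is_intpart parts }.

HB.instance Definition _ := [isSub for parts].
HB.instance Definition _ := [Countable of intpart by <:].

Definition part (la : intpart) (i : nat) : nat := nth 0%N la i.
Definition length_part (la : intpart) : nat := size la.

Definition conj_parts (la : intpart) : seq nat :=
  mkseq (fun i => count (fun p => (i < p)%N) la) (part la 0).

Fact conj_parts_proof la : is_intpart (conj_parts la).
Proof.
case: la => s hs; have /andP[s_sorted s0] := hs; rewrite /conj_parts /part /=.
apply/andP; split.
  apply: (@homo_sorted _ _ (fun i => count (fun p => (i < p)%N) s) ltn).
    move=> i j ij; apply: sub_count => p /=; exact: (ltn_trans ij).
  exact: iota_ltn_sorted.
apply/mapP => -[i]; rewrite mem_iota /= add0n.
case: s s0 {hs s_sorted} => //= p s _ ip.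
by rewrite ip.
Qed.

Definition conj_part (la : intpart) : intpart := IntPart (conj_parts_proof la).

Definition nstat (la : intpart) : nat := (\sum_(i < size la) i * part la i)%N.

(* The omitted terms have part la i = 0. *)
Definition pairing (la mu : intpart) : nat :=
  (\sum_(i < size la) part la i * part mu i)%N.

(* -------------------------------------------------------------------- *)
Local Close Scope classical_set_scope.

(* q may be any element of any field; an indeterminate q over a field k is the
   case of q = 'X in the field of rational functions over k. *)
Section HallLittlewood.
Context (F : fieldType) (q : F).

Section Finite.
Context (n : nat) (la : intpart).

(* The rational function x^la \prod_(la_i > la_j) (x_i - q x_j) / (x_i - x_j)
   with its variables permuted by w (la_i > la_j forces i < j). *)
Definition hl_term (w : 'S_n) : {fraction {mpoly F[n]}} :=
  let x (i : 'I_n) := tofrac 'X_(w i) in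
  (\prod_(i < n) x i ^+ part la i) *
  \prod_(i < n) \prod_(j < n | (part la j < part la i)%N)
     ((x i - tofrac q%:MP * x j) / (x i - x j)).

Definition part_stab : {set 'S_n} :=
  [set w : 'S_n | [forall i : 'I_n, part la (w i) == part la i]]%SET.

(* In the group 'S_n, v * w is "first v, then w", so that the classes on which
   hl_term is constant (the left cosets of the stabilizer for the usual
   composition of permutations) are right cosets. *)
Definition hl_frac : {fraction {mpoly F[n]}} :=
  if (length_part la <= n)%N then
    \sum_(C in rcosets part_stab [set: 'S_n]%SET) hl_term (repr C)
  else 0.

(* The polynomial equal to the rational function hl_frac: unique since tofrac is
   injective, and existing since hl_frac is symmetric and the Vandermonde
   determinant is a common denominator of its terms. *)
Definition hl_poly : {mpoly F[n]} := xget 0 [set p | tofrac p = hl_frac]%classic.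

End Finite.

(* The coefficient of a monomial m in the symmetric function P_la is read off
   from P_la(x_0, ..., x_(n-1)) where n is large enough for m to involve only
   these variables; by stability any such n gives the same value. *)
Definition cmonom_bound (m : {cmonom nat}) : nat := \max_(i <- finsupp m) i.+1.

Definition hl (la : intpart) : fps nat F :=
  Fps (fun m => let n := cmonom_bound m in
                (hl_poly n la)@_[multinom m i | i < n]).

End HallLittlewood.

(* Main.v *)
Require Import Defs.
From HB Require Import structures.
From mathcomp Require Import all_boot all_order all_algebra all_fingroup.
From mathcomp Require Import finmap boolp classical_sets functions cardinality.
From mathcomp Require Import fsbigop.
From mathcomp Require Import monalg mpoly.
From mathcomp Require Import ring zify.

Set Implicit Arguments.
Unset Strict Implicit.
Unset Printing Implicit Defensive.

Import Order.TTheory GRing.Theory.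
Import mathcomp.boot.fintype mathcomp.boot.finset.

Local Open Scope ring_scope.

(** * The peeling identity *)

(** In finitely many variables, the coset sum defining P_lambda is a sum over the rearrangements of
    lambda, that is, over functions f on the variables whose sorted nonzero values are the parts of
    lambda ([hl_frac_sum], [hl_polyE]). The left side thus becomes a sum over pairs of functions (f,
    g). Its exponent is the sum over levels k of binom(a_k, 2) + binom(b_k, 2) - a_k b_k, where a_k
    and b_k count the i with f(i) > k and the j with g(j) > k, since these counts are the conjugate
    parts ([card_level_set], [tofrac_hl_weight]).

    Write f = 1_I + f' with I the support of f. The summand of f on the alphabet X is an explicit
    factor of I and X times the summand of f' on the alphabet I ([hl_summand_shift]). Hence the
    double sum obeys a recursion S(X,Y) = sum over I, J of w_X(I) w_Y(J) q^(-|I||J|) S(I,J), in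
    which a bound on the values drops by one ([pair_sumS]). The heart of the proof is that the
    product side obeys the same recursion. After clearing denominators this is the rational identity
    [peel_identity], proved by adjoining one x at a time. As a polynomial in the new variable, the
    difference of the two sides has degree at most |X| + |Y|. It vanishes at 0 and at each q / y_b
    by smaller instances of the identity, and at each old x_c because terms cancel in pairs.

    Now restrict f and g to values at most B. The defect, numerator minus denominator times
    truncated sum, obeys the recursion as well ([pair_sum_defect]). Its term I = J = empty is zero
    and every other term gains degree |I| + |J| >= 1, so the defect has order at least B
    ([ford_defect]). Orders are measured on rational functions with homogeneous denominators.

    The poles of P_lambda along x_i = x_j cancel between f and its swap ([hl_sum_polynomial]), so
    the defect is a polynomial of order at least B ([mord_box_defect]). A fixed monomial involves
    finitely many variables and receives contributions only from partitions in a finite box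
    ([coef_hl_pair_eq0]). Taking B above its degree makes its coefficients on both sides agree
    ([phi_box_sum], [hl_sum_infprod]). *)

Lemma big_subsetU1 (R : nmodType) (T : finType) (a : T) (X : {set T})
    (F : {set T} -> R) : a \notin X ->
  \sum_(I : {set T} | I \subset (a |: X)%SET) F I =
  \sum_(I : {set T} | I \subset X) (F I + F (a |: I)%SET).
Proof.
move=> aX; rewrite (bigID (fun I : {set T} => a \in I)) /= addrC big_split /=.
congr (_ + _).
  apply: eq_bigl => I; rewrite -subsetD1.
  by rewrite setU1K.
rewrite (reindex_onto (fun I => a |: I)%SET (fun I => I :\ a)%SET) /=; last first.
  by move=> I /andP[_ aI]; rewrite setD1K.
apply: eq_bigl => I; rewrite setU11 andbT.
apply/andP/idP => [[sI /eqP eI]|sI].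
  have aI : a \notin I by rewrite -eI setD11.
  by move: (setSD [set a]%SET sI); rewrite !setU1K.
rewrite setUS // setU1K //.
by apply: contra aX; apply: (subsetP sI).
Qed.

Section KeyIdentity.
Variables (E : fieldType) (q : E).

(** The factor by which splitting off a first level set [I] multiplies a summand, times the
    denominators [1 - x k] of the product side that disappear when the alphabet shrinks from [X] to
    [I]. *)
Definition peel_weight (T : finType) (x : T -> E) (X I : {set T}) : E :=
  q ^+ 'C(#|I|, 2) * \prod_(k in X) (if k \in I then x k else 1 - x k) *
  \prod_(i in X) \prod_(k in X)
    (if (i \in I) && (k \notin I) then (x i - q * x k) / (x i - x k) else 1).

(** Combines the coupling q^(-|I||J|) of two level sets with the product of (1 - x_i y_j) / (1 -
    q^-1 x_i y_j) over I and J. *)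
Definition peel_kernel (T U : finType) (x : T -> E) (y : U -> E)
    (X I : {set T}) (Y J : {set U}) : E :=
  \prod_(i in X) \prod_(j in Y)
    (if (i \in I) && (j \in J) then (1 - x i * y j) / (q - x i * y j) else 1).

Section OneMore.
Variables (T : finType) (x : T -> E) (a : T) (X I : {set T}).
Hypotheses (aX : a \notin X) (IX : I \subset X).

Let aI : a \notin I. Proof. by apply: contra aX; apply: (subsetP IX). Qed.

Let mem_aI k : k \in X -> (k \in (a |: I)%SET) = (k \in I).
Proof. by move=> kX; rewrite in_setU1; case: eqP => // ka; move: aX; rewrite -ka kX. Qed.

Lemma prod_const_subset (c : E) :
  \prod_(k in X) (if k \in I then c else 1) = c ^+ #|I|.
Proof.
rewrite -prodr_const -big_mkcondr; apply: eq_bigl => k.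
by case kI : (k \in I); rewrite ?andbF // (subsetP IX).
Qed.

Lemma peel_weightU1_out :
  peel_weight x (a |: X)%SET I =
  peel_weight x X I * ((1 - x a) *
    \prod_(k in X) (if k \in I then (x k - q * x a) / (x k - x a) else 1)).
Proof.
rewrite /peel_weight !big_setU1 //= (negbTE aI) /=.
rewrite big1_eq !mul1r.
under [X in _ * X = _]eq_bigr => i _ do rewrite big_setU1 //= aI andbT.
rewrite big_split /=; ring.
Qed.

(** From binom(|I|+1, 2) = binom(|I|, 2) + |I| comes an extra q^|I|. It is written as one factor [q]
    per element of [I], so that the dependence on [x a] can be handled factor by factor. *)
Lemma peel_weightU1_in :
  peel_weight x (a |: X)%SET (a |: I)%SET =
  peel_weight x X I * (x a *
    \prod_(k in X) (if k \in I then q else (x a - q * x k) / (x a - x k))).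
Proof.
rewrite /peel_weight !big_setU1 //= cardsU1 aI add1n binS bin1 exprD setU11 /=.
rewrite mul1r -prod_const_subset.
set Q := \prod_(k in X) (if k \in I then q else 1).
have -> : \prod_(k in X) (if k \in (a |: I)%SET then x k else 1 - x k) =
    \prod_(k in X) (if k \in I then x k else 1 - x k).
  by apply: eq_bigr => k kX; rewrite mem_aI.
have -> : \prod_(k in X) (if k \notin (a |: I)%SET then
      (x a - q * x k) / (x a - x k) else 1) =
    \prod_(k in X) (if k \in I then 1 else (x a - q * x k) / (x a - x k)).
  by apply: eq_bigr => k kX; rewrite mem_aI //; case: (k \in I).
have -> : \prod_(i in X) \prod_(k in (a |: X)%SET)
      (if (i \in (a |: I)%SET) && (k \notin (a |: I)%SET)
       then (x i - q * x k) / (x i - x k) else 1) =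
    \prod_(i in X) \prod_(k in X)
      (if (i \in I) && (k \notin I) then (x i - q * x k) / (x i - x k) else 1).
  apply: eq_bigr => i iX; rewrite big_setU1 //= setU11 andbF mul1r.
  by apply: eq_bigr => k kX; rewrite !mem_aI.
have -> : \prod_(k in X) (if k \in I then q else (x a - q * x k) / (x a - x k))
  = Q * \prod_(k in X) (if k \in I then 1 else (x a - q * x k) / (x a - x k)).
  by rewrite -big_split /=; apply: eq_bigr => k _; case: ifP; rewrite ?mulr1 ?mul1r.
ring.
Qed.

Variables (U : finType) (y : U -> E) (Y J : {set U}).

Lemma peel_kernelU1_out :
  peel_kernel x y (a |: X)%SET I Y J = peel_kernel x y X I Y J.
Proof.
by rewrite /peel_kernel big_setU1 //= (negbTE aI) /= big1_eq mul1r.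
Qed.

Lemma peel_kernelU1_in :
  peel_kernel x y (a |: X)%SET (a |: I)%SET Y J =
  peel_kernel x y X I Y J *
  \prod_(j in Y) (if j \in J then (1 - x a * y j) / (q - x a * y j) else 1).
Proof.
rewrite /peel_kernel big_setU1 //= setU11 /= mulrC; congr (_ * _).
by apply: eq_bigr => i iX; apply: eq_bigr => j jY; rewrite mem_aI.
Qed.

End OneMore.

Lemma peel_kernelC (T U : finType) (x : T -> E) (y : U -> E) X I Y J :
  peel_kernel x y X I Y J = peel_kernel y x Y J X I.
Proof.
rewrite /peel_kernel exchange_big /=; apply: eq_bigr => j _.
by apply: eq_bigr => i _; rewrite andbC [x i * y j]mulrC.
Qed.

Definition peel_sum (T U : finType) (x : T -> E) (y : U -> E)
    (X : {set T}) (Y : {set U}) : E :=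
  \sum_(I : {set T} | I \subset X) \sum_(J : {set U} | J \subset Y)
    peel_weight x X I * peel_weight y Y J * peel_kernel x y X I Y J.

Definition peel_value (T U : finType) (x : T -> E) (y : U -> E)
    (X : {set T}) (Y : {set U}) : E :=
  \prod_(i in X) \prod_(j in Y) (q * (1 - x i * y j) / (q - x i * y j)).

(** Keeps the denominators nonzero and, together with [q != 0], makes the interpolation nodes 0, x_c
    and q / y_b pairwise distinct. *)
Definition generic (T U : finType) (x : T -> E) (y : U -> E)
    (X : {set T}) (Y : {set U}) : Prop :=
  [/\ {in X &, injective x}, {in Y &, injective y},
      {in X, forall i, x i != 0}, {in Y, forall j, y j != 0}
    & {in X & Y, forall i j, q - x i * y j != 0}].

Lemma genericS (T U : finType) (x : T -> E) (y : U -> E)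
    (X X' : {set T}) (Y Y' : {set U}) : X' \subset X -> Y' \subset Y ->
  generic x y X Y -> generic x y X' Y'.
Proof.
move=> /subsetP sX /subsetP sY [ix iy x0 y0 xy]; split.
- by move=> i j /sX iX /sX jX; apply: ix.
- by move=> i j /sY iX /sY jX; apply: iy.
- by move=> i /sX; apply: x0.
- by move=> i /sY; apply: y0.
- by move=> i j /sX iX /sY jY; apply: xy.
Qed.

Lemma peel_sumC (T U : finType) (x : T -> E) (y : U -> E)
    (X : {set T}) (Y : {set U}) :
  peel_sum x y X Y = peel_sum y x Y X.
Proof.
rewrite /peel_sum exchange_big /=; apply: eq_bigr => J _; apply: eq_bigr => I _.
by rewrite peel_kernelC [peel_weight x _ _ * _]mulrC.
Qed.

(** The coefficient [c] may be zero, so degrees and top coefficients multiply without side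
    conditions and can cancel in sums. *)
Definition top_coef (p : {poly E}) (n : nat) (c : E) :=
  (size p <= n.+1)%N /\ p`_n = c.

Lemma top_coefM p1 p2 n1 n2 c1 c2 : top_coef p1 n1 c1 -> top_coef p2 n2 c2 ->
  top_coef (p1 * p2) (n1 + n2) (c1 * c2).
Proof.
move=> [s1 <-] [s2 <-]; split.
  apply: leq_trans (size_polyMleq _ _) _.
  by rewrite -subn1 leq_subLR; lia.
rewrite coefM (bigD1 (inord n1)) //= inordK ?ltnS ?leq_addr // addKn.
rewrite big1 ?addr0 // => i /eqP ni.
have {}ni : nat_of_ord i <> n1 by move=> e; apply: ni; apply: val_inj; rewrite /= inordK ?ltnS ?leq_addr.
have [lt|ge] := ltnP i n1.
  by rewrite [p2`__]nth_default ?mulr0 //; apply: (leq_trans s2); lia.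
by rewrite [p1`__]nth_default ?mul0r //; apply: (leq_trans s1); lia.
Qed.


Definition lin (c d : E) : {poly E} := c *: 'X + d%:P.

Lemma linE c d z : (lin c d).[z] = c * z + d.
Proof. by rewrite /lin !hornerE. Qed.

Lemma top_coef_lin c d : top_coef (lin c d) 1 c.
Proof.
split; last by rewrite /lin coefD coefZ coefX coefC /= mulr1 addr0.
rewrite (leq_trans (size_polyD _ _)) // geq_max (leq_trans (size_scale_leq _ _)) ?size_polyX //=.
by rewrite (leq_trans (size_polyC_leq1 _)).
Qed.

Lemma top_coef_prod (T : finType) (X : {set T}) (c d : T -> E) :
  top_coef (\prod_(k in X) lin (c k) (d k)) #|X| (\prod_(k in X) c k).
Proof.
rewrite -sum1_card.
apply: (big_rec3 (fun n p e => top_coef p n e)).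
  by split; rewrite ?size_poly1 // coef1.
move=> k n p e _ h; exact: top_coefM (top_coef_lin _ _) h.
Qed.

Lemma poly_eq0_roots (p : {poly E}) (s : seq E) :
  (size p <= size s)%N -> uniq s -> {in s, forall z, p.[z] = 0} -> p = 0.
Proof.
move=> sp us zs; apply: (roots_geq_poly_eq0 _ us sp).
by apply/allP => z /zs /eqP.
Qed.

(** * Adjoining one variable by counting roots *)

Section Step.
Variables (T U : finType) (x : T -> E) (y : U -> E) (a : T).
Variables (X : {set T}) (Y : {set U}).
Hypotheses (q0 : q != 0) (aX : a \notin X).
Hypothesis gen : generic x y (a |: X)%SET Y.
Hypothesis IH : forall Y' : {set U}, Y' \subset Y ->
  peel_sum x y X Y' = peel_value x y X Y'.

Let genX : generic x y X Y.
Proof. by apply: genericS gen => //; apply: subsetUr. Qed.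

(** Put z for [x a] and clear denominators by [D]. Then [PA I J] comes from adding [a] to [I],
    [PB I] from leaving [a] out, and [PC] from the product side. Thus [G] at [x a] is [D] times the
    difference of the two sides for the alphabet with [a] adjoined. *)
Let PA (I : {set T}) (J : {set U}) : {poly E} :=
  lin (q ^+ #|I|) 0 *
  \prod_(k in X) lin 1 (if k \in I then - x k else - (q * x k)) *
  \prod_(j in Y) lin (- y j) (if j \in J then 1 else q).
Let PB (I : {set T}) : {poly E} :=
  lin (-1) 1 *
  \prod_(k in X) lin (if k \in I then q else 1) (- x k) *
  \prod_(j in Y) lin (- y j) q.
Let PC : {poly E} :=
  \prod_(k in X) lin 1 (- x k) * \prod_(j in Y) lin (- y j) 1.
Let w I J := peel_weight x X I * peel_weight y Y J * peel_kernel x y X I Y J.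
Let G : {poly E} :=
  \sum_(I : {set T} | I \subset X) \sum_(J : {set U} | J \subset Y)
    w I J *: (PA I J + PB I) - (q ^+ #|Y| * peel_value x y X Y) *: PC.
Let D (z : E) := \prod_(k in X) (z - x k) * \prod_(j in Y) (q - z * y j).

Let PA_E I J z : (PA I J).[z] = q ^+ #|I| * z *
  \prod_(k in X) (if k \in I then z - x k else z - q * x k) *
  \prod_(j in Y) (if j \in J then 1 - z * y j else q - z * y j).
Proof.
rewrite /PA !hornerM !horner_prod linE addr0; congr (_ * _ * _).
  by apply: eq_bigr => k _; rewrite linE mul1r; case: ifP.
by apply: eq_bigr => k _; rewrite linE mulNr addrC [y k * z]mulrC; case: ifP.
Qed.

Let PB_E I z : (PB I).[z] = (1 - z) *
  \prod_(k in X) (if k \in I then q * z - x k else z - x k) *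
  \prod_(j in Y) (q - z * y j).
Proof.
rewrite /PB !hornerM !horner_prod linE mulN1r addrC; congr (_ * _ * _).
  by apply: eq_bigr => k _; rewrite linE; case: ifP; rewrite ?mul1r.
by apply: eq_bigr => k _; rewrite linE mulNr addrC [y k * z]mulrC.
Qed.

Let PC_E z : PC.[z] = \prod_(k in X) (z - x k) * \prod_(j in Y) (1 - z * y j).
Proof.
rewrite /PC !hornerM !horner_prod; congr (_ * _).
  by apply: eq_bigr => k _; rewrite linE mul1r.
by apply: eq_bigr => k _; rewrite linE mulNr addrC [y k * z]mulrC.
Qed.

Let G_E z : G.[z] =
  \sum_(I : {set T} | I \subset X) \sum_(J : {set U} | J \subset Y)
    (w I J * ((PA I J).[z] + (PB I).[z])) - q ^+ #|Y| * peel_value x y X Y * PC.[z].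
Proof.
rewrite /G hornerD hornerN hornerZ horner_sum; congr (_ - _).
apply: eq_bigr => I _; rewrite horner_sum; apply: eq_bigr => J _.
by rewrite hornerZ hornerD.
Qed.

(** [PA] and [PB] have formal degree |X| + |Y| + 1, with opposite top coefficients: both are q^|I|
    times the product of the - y_j, up to sign. [PC] has degree one less, so the degree of [G] drops
    by one. *)
Let size_G : (size G <= (#|X| + #|Y|).+1)%N.
Proof.
have topG : top_coef G (1 + #|X| + #|Y|) 0.
  split; last first.
    rewrite /G coefB coefZ coef_sum.
    have [s0 _] := top_coefM (top_coef_prod X (fun=> 1) (fun k => - x k))
                        (top_coef_prod Y (fun j => - y j) (fun=> 1)).
    rewrite (nth_default _ (leq_trans s0 _)) ?mulr0 ?subr0; last by rewrite -addnA.
    rewrite big1 // => I IX; rewrite coef_sum big1 // => J JY.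
    rewrite coefZ coefD.
    have [_ ->] := top_coefM (top_coefM (top_coef_lin (q ^+ #|I|) 0)
       (top_coef_prod X (fun=> 1) (fun k => if k \in I then - x k else - (q * x k))))
       (top_coef_prod Y (fun j => - y j) (fun j => if j \in J then 1 else q)).
    have [_ ->] := top_coefM (top_coefM (top_coef_lin (-1) 1)
       (top_coef_prod X (fun k => if k \in I then q else 1) (fun k => - x k)))
       (top_coef_prod Y (fun j => - y j) (fun=> q)).
    by rewrite big1_eq prod_const_subset //; ring.
  have szD (p r : {poly E}) n : (size p <= n)%N -> (size r <= n)%N -> (size (p + r)%R <= n)%N.
    by move=> sp sr; rewrite (leq_trans (size_polyD _ _)) // geq_max sp.
  rewrite /G; apply: (szD); last first.
    rewrite size_polyN (leq_trans (size_scale_leq _ _)) //.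
    have [s0 _] := top_coefM (top_coef_prod X (fun=> 1) (fun k => - x k))
                        (top_coef_prod Y (fun j => - y j) (fun=> 1)).
    by apply: leq_trans s0 _; rewrite -addnA.
  apply: (big_ind (fun p : {poly E} => (size p <= (1 + #|X| + #|Y|).+1)%N)).
  - by rewrite size_poly0.
  - by move=> p r; apply: (szD).
  move=> I IX; apply: (big_ind (fun p : {poly E} => (size p <= (1 + #|X| + #|Y|).+1)%N)).
  - by rewrite size_poly0.
  - by move=> p r; apply: (szD).
  move=> J JY; rewrite (leq_trans (size_scale_leq _ _)) //; apply: (szD).
    by have [] := top_coefM (top_coefM (top_coef_lin (q ^+ #|I|) 0)
       (top_coef_prod X (fun=> 1) (fun k => if k \in I then - x k else - (q * x k))))
       (top_coef_prod Y (fun j => - y j) (fun j => if j \in J then 1 else q)).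
  by have [] := top_coefM (top_coefM (top_coef_lin (-1) 1)
       (top_coef_prod X (fun k => if k \in I then q else 1) (fun k => - x k)))
       (top_coef_prod Y (fun j => - y j) (fun=> q)).
(* A size of |X| + |Y| + 2 would make the vanishing coefficient the leading one. *)
case: topG => sG cG; have [//|ne] := leqP (size G) (#|X| + #|Y|).+1.
have sE : size G = (#|X| + #|Y|).+2 by apply/eqP; rewrite eqn_leq ne andbT.
by move: cG; rewrite -[(1 + _ + _)%N]/(#|X| + #|Y|).+2.-1 -sE => /eqP;
  rewrite -/(lead_coef G) lead_coef_eq0 -size_poly_eq0 sE.
Qed.

(** At 0 every [PA] vanishes, while [PB] and [PC] become constants independent of I and J; the
    induction hypothesis for X and Y remains. *)
Let G_0 : G.[0] = 0.
Proof.
rewrite G_E; apply/eqP; rewrite subr_eq0 -(IH (subxx Y)) PC_E; apply/eqP.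
rewrite /peel_sum mulr_sumr mulr_suml; apply: eq_bigr => I IX.
rewrite mulr_sumr mulr_suml; apply: eq_bigr => J JY.
rewrite PA_E PB_E mulr0 !mul0r add0r -/(w I J) subr0 mul1r.
have -> : \prod_(k in X) (if k \in I then q * 0 - x k else 0 - x k) =
   \prod_(k in X) (0 - x k) by apply: eq_bigr => k _; rewrite mulr0 if_same.
have -> : \prod_(j in Y) (q - 0 * y j) = q ^+ #|Y|.
  by rewrite -prodr_const; apply: eq_bigr => j _; rewrite mul0r subr0.
have -> : \prod_(j in Y) (1 - 0 * y j) = 1.
  by rewrite big1 // => j _; rewrite mul0r subr0.
ring.
Qed.

(** At x_c, [PC] vanishes, [PA] survives only when c is outside I, and [PB] only when c is in I. The
    [PA] term of I cancels the [PB] term of I with c adjoined: when [x a] equals x_c, exchanging a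
    and c reverses the sign of the residue. *)
Let G_x c : c \in X -> G.[x c] = 0.
Proof.
move=> cX; have [ix iy x0 y0 xy] := genX.
rewrite G_E PC_E (bigD1 c) //= subrr !mul0r mulr0 subr0.
set X' := (X :\ c)%SET; have cX' : c \notin X' by rewrite setD11.
have eX : X = (c |: X')%SET by rewrite setD1K.
have sX' k : k \in X' -> k \in X by rewrite eX !inE => ->; rewrite orbT.
rewrite [in X in X = _]eX big_subsetU1 // big1 // => I IX.
rewrite -big_split big1 //= => J JY.
have cI : c \notin I by apply: contra cX'; apply: (subsetP IX).
have mem_cI k : k \in X' -> (k \in (c |: I)%SET) = (k \in I).
  by move=> kX; rewrite in_setU1; case: eqP => // kc; move: cX'; rewrite -kc kX.
rewrite !PA_E !PB_E /w eX peel_weightU1_out // peel_weightU1_in //.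
rewrite peel_kernelU1_out // peel_kernelU1_in //.
rewrite !(big_setU1 _ cX') /= (negbTE cI) setU11 subrr !mul0r !mulr0 !mul0r.
rewrite addr0 add0r.
have -> : \prod_(k in X') (if k \in (c |: I)%SET then q * x c - x k else x c - x k) =
  \prod_(k in X') (if k \in I then q * x c - x k else x c - x k).
  by apply: eq_bigr => k kX; rewrite mem_cI.
rewrite -(prod_const_subset IX).
set W := peel_weight x X' I; set W' := peel_weight y Y J; set K := peel_kernel _ _ _ _ _ _.
set a1 := \prod_(k in X') _; set a2 := \prod_(k in X') _; set a3 := \prod_(k in X') _.
set a4 := \prod_(k in X') _; set a5 := \prod_(k in X') _.
set b1 := \prod_(j in Y) (if j \in J then 1 - x c * y j else _).
set b2 := \prod_(j in Y) (if j \in J then _ else 1); set b3 := \prod_(j in Y) _.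
have e1 : a1 * a4 * a3 = a2 * a5.
  rewrite -!big_split /=; apply: eq_bigr => k kX.
  have ne : x c - x k != 0.
    by rewrite subr_eq0; apply: contra cX' => /eqP/ix -> //; apply: sX'.
  have ne' : x k - x c != 0 by rewrite -opprB oppr_eq0.
  by case: ifP => _; field.
have e2 : b1 = b2 * b3.
  rewrite -!big_split /=; apply: eq_bigr => j jY; have := xy _ _ cX jY.
  by case: ifP => _ ne; field.
transitivity (W * W' * K * (1 - x c) * x c * (x c - q * x c) *
   (a1 * a4 * a3 * b1 - a2 * a5 * (b2 * b3))); first ring.
by rewrite e1 e2 subrr mulr0.
Qed.

(** At q / y_b the factor q - z y_b kills [PB], and kills [PA] unless b is in J. Removing b from J
    leaves the induction hypothesis for Y without b, with (z - q x_k) / (z - x_k) as the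
    contribution of b to the product side. *)
Let G_y b : b \in Y -> G.[q / y b] = 0.
Proof.
move=> bY; have [ix iy x0 y0 xy] := genX.
set Y' := (Y :\ b)%SET; have bY' : b \notin Y' by rewrite setD11.
have eY : Y = (b |: Y')%SET by rewrite setD1K.
have sY' : Y' \subset Y by rewrite eY subsetUr.
have yb0 := y0 _ bY; set z := q / y b.
have zb : z * y b = q by rewrite divfK.
(* From here on only z y_b = q matters; it is used to eliminate q. *)
clearbody z.
have zx k : k \in X -> z - x k != 0.
  move=> kX; apply: contra (xy _ _ kX bY) => /eqP zxk.
  by rewrite -zb -mulrBl zxk mul0r.
have yy k : k \in Y' -> y b - y k != 0.
  move=> kY; rewrite subr_eq0; apply: contra bY' => /eqP bk.
  by rewrite (iy _ _ bY (subsetP sY' _ kY) bk).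
rewrite G_E PC_E; apply/eqP; rewrite subr_eq0; apply/eqP.
have -> : peel_value x y X Y = peel_value x y X Y' *
    \prod_(k in X) ((z - q * x k) / (z - x k)).
  rewrite /peel_value -big_split /=; apply: eq_bigr => k kX.
  rewrite eY big_setU1 //= mulrC; congr (_ * _).
  have := zx _ kX; have := xy _ _ kX bY; rewrite -zb => h1 h2.
  by field; rewrite h1 h2.
rewrite -(IH sY') /peel_sum !(mulr_sumr, mulr_suml); apply: eq_bigr => I IX.
rewrite [in X in X = _]eY big_subsetU1 // !(mulr_sumr, mulr_suml).
apply: eq_bigr => J JY.
have bJ : b \notin J by apply: contra bY'; apply: (subsetP JY).
have mem_bJ k : k \in Y' -> (k \in (b |: J)%SET) = (k \in J).
  by move=> kY; rewrite in_setU1; case: eqP => // kb; move: bY'; rewrite -kb kY.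
have B0 : (PB I).[z] = 0 by rewrite PB_E eY big_setU1 //= zb subrr mul0r mulr0.
have A0 : (PA I J).[z] = 0.
  by rewrite PA_E eY big_setU1 //= (negbTE bJ) zb subrr mul0r mulr0.
rewrite A0 B0 !addr0 mulr0 add0r PA_E /w eY peel_weightU1_in //.
rewrite peel_kernelC peel_kernelU1_in // [peel_kernel y x _ _ _ _]peel_kernelC.
rewrite !(big_setU1 _ bY') /= setU11 zb cardsU1 bY' exprS.
rewrite -(prod_const_subset IX).
have -> : \prod_(k in Y') (if k \in (b |: J)%SET then 1 - z * y k else q - z * y k) =
  \prod_(k in Y') (if k \in J then 1 - z * y k else q - z * y k).
  by apply: eq_bigr => k kX; rewrite mem_bJ.
set W := peel_weight x X I; set W' := peel_weight y Y' J; set K := peel_kernel _ _ _ _ _ _.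
set a1 := \prod_(k in X) (if k \in I then q else 1).
set a2 := \prod_(k in X) (if k \in I then z - x k else _).
set a3 := \prod_(k in X) (z - x k).
set a4 := \prod_(k in X) (if k \in I then _ / _ else 1).
set a5 := \prod_(k in X) (_ / _).
set b1 := \prod_(j in Y') (if j \in J then q else _).
set b2 := \prod_(j in Y') (if j \in J then 1 - z * y j else _).
set b3 := \prod_(j in Y') (1 - z * y j).
have e1 : a4 * (a1 * a2) = a5 * a3.
  rewrite -!big_split /=; apply: eq_bigr => k kX.
  have := zx _ kX; have := xy _ _ kX bY; case: ifP => _ h1 h2; last by rewrite !mul1r divfK.
  by rewrite divfK //; rewrite -zb in h1 *; field; rewrite [y b * _]mulrC h1.
have e2 : b1 * b2 = q ^+ #|Y'| * b3.
  rewrite -prodr_const -!big_split /=; apply: eq_bigr => k /yy kY.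
  by case: ifP => _ //; rewrite -zb; field.
transitivity (W * W' * K * (y b * z) * (1 - q) * (a4 * (a1 * a2)) * (b1 * b2)).
  ring.
by rewrite e1 e2 [y b * z]mulrC zb; ring.
Qed.

Let G_eq0 : G = 0.
Proof.
have [ix iy x0 y0 xy] := genX.
(* These 1 + |X| + |Y| distinct roots exceed the degree bound on [G]. *)
apply: (@poly_eq0_roots _
  (0 :: [seq x c | c <- enum X] ++ [seq q / y b | b <- enum Y])).
- rewrite /= size_cat !size_map -!cardE. exact: leq_trans size_G _.
- rewrite /= cat_uniq mem_cat negb_or -andbA; apply/and5P; split.
  + by apply/mapP => -[c]; rewrite mem_enum => /x0/negP cX /esym/eqP.
  + apply/mapP => -[b]; rewrite mem_enum => /y0 yb0 /esym/eqP.
    by rewrite mulf_eq0 (negbTE q0) invr_eq0 (negbTE yb0).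
  + rewrite map_inj_in_uniq ?enum_uniq // => c d; rewrite !mem_enum; exact: ix.
  + apply/hasP => -[z /mapP[b]]; rewrite mem_enum => bY -> /mapP[c].
    rewrite mem_enum => cX e; have := xy _ _ cX bY.
    by rewrite -e divfK ?subrr ?eqxx // y0.
  + rewrite map_inj_in_uniq ?enum_uniq // => b d; rewrite !mem_enum => bY dY.
    by move=> /(mulfI q0)/invr_inj; apply: iy.
- move=> z; rewrite inE mem_cat => /or3P[/eqP->|/mapP[c]|/mapP[b]].
  + exact: G_0.
  + by rewrite mem_enum => cX ->; apply: G_x.
  + by rewrite mem_enum => bY ->; apply: G_y.
Qed.

Lemma peel_step : peel_sum x y (a |: X)%SET Y = peel_value x y (a |: X)%SET Y.
Proof.
have [ix iy x0 y0 xy] := gen.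
(* With [D] nonzero at [x a], the vanishing of [G] there can be divided by it. *)
have Dn0 : D (x a) != 0.
  rewrite mulf_neq0 //; apply/prodf_neq0 => k kX.
    rewrite subr_eq0; apply: contra aX => /eqP/ix.
    by rewrite !inE eqxx kX orbT => -> //.
  by rewrite xy // setU11.
have := G_E (x a); rewrite G_eq0 horner0 => /esym/eqP; rewrite subr_eq0 => /eqP eqG.
rewrite PC_E in eqG.
have -> : peel_value x y (a |: X)%SET Y = peel_value x y X Y *
    (q ^+ #|Y| * \prod_(j in Y) (1 - x a * y j) / \prod_(j in Y) (q - x a * y j)).
  rewrite /peel_value big_setU1 //= mulrC; congr (_ * _).
  by rewrite -prodr_const -big_split -prodf_div.
have Y0 : \prod_(j in Y) (q - x a * y j) != 0.
  by apply/prodf_neq0 => j jY; rewrite xy // setU11.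
apply: (mulfI Dn0); transitivity (q ^+ #|Y| * peel_value x y X Y *
  (\prod_(k in X) (x a - x k) * \prod_(j in Y) (1 - x a * y j))); last first.
  by rewrite /D; field.
rewrite -eqG /peel_sum big_subsetU1 // mulr_sumr; apply: eq_bigr => I IX.
rewrite -big_split mulr_sumr; apply: eq_bigr => J JY /=.
rewrite PA_E PB_E peel_weightU1_out // peel_weightU1_in // /w.
rewrite peel_kernelU1_out // peel_kernelU1_in // -(prod_const_subset IX).
set W := peel_weight x X I; set W' := peel_weight y Y J; set K := peel_kernel _ _ _ _ _ _.
rewrite /D.
set a1 := \prod_(k in X) (x a - x k).
set a2 := \prod_(k in X) (if k \in I then (_ / _) else 1).
set a3 := \prod_(k in X) (if k \in I then q else (_ / _)).
set a4 := \prod_(k in X) (if k \in I then q else 1).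
set a5 := \prod_(k in X) (if k \in I then x a - x k else _).
set a6 := \prod_(k in X) (if k \in I then q * x a - x k else _).
set b1 := \prod_(j in Y) (q - x a * y j).
set b2 := \prod_(j in Y) (if j \in J then (_ / _) else 1).
set b3 := \prod_(j in Y) _.
have ne k : k \in X -> (x a - x k != 0) /\ (x k - x a != 0).
  move=> kX; rewrite -[x k - _]opprB oppr_eq0; split; rewrite subr_eq0;
  by apply: contra aX => /eqP/ix -> //; rewrite ?setU11 // !inE kX orbT.
have e1 : a1 * a2 = a6.
  rewrite -!big_split /=; apply: eq_bigr => k /ne [n1 n2].
  by case: ifP => _; [field | rewrite mulr1].
have e2 : a1 * a3 = a4 * a5.
  rewrite -!big_split /=; apply: eq_bigr => k /ne [n1 n2].
  by case: ifP => _; [ring | field].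
have e3 : b1 * b2 = b3.
  rewrite -!big_split /=; apply: eq_bigr => j jY; have ye := xy _ _ (setU11 _ _) jY.
  by case: ifP => _; [field | rewrite mulr1].
transitivity (W * W' * K * ((1 - x a) * (a1 * a2) * b1 + x a * (a1 * a3) * (b1 * b2))).
  ring.
by rewrite e1 e2 e3; ring.
Qed.

End Step.

Lemma peel_sum_set0 (T U : finType) (x : T -> E) (y : U -> E) :
  peel_sum x y set0 set0 = 1.
Proof.
rewrite /peel_sum (big_pred1 (set0 : {set T})) => [|I]; last by rewrite subset0.
rewrite (big_pred1 (set0 : {set U})) => [|I]; last by rewrite subset0.
by rewrite /peel_weight /peel_kernel !cards0 !big_set0 !expr0 !mulr1.
Qed.

(** Induction on |X|, quantified over the subsets of Y because the root q / y_b removes an element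
    of Y. The case of empty X is left as a hypothesis. *)
Lemma peel_identity_step (T U : finType) (x : T -> E) (y : U -> E)
    (X : {set T}) (Y : {set U}) : q != 0 ->
  (forall Y' : {set U}, Y' \subset Y -> peel_sum x y set0 Y' = peel_value x y set0 Y') ->
  generic x y X Y -> peel_sum x y X Y = peel_value x y X Y.
Proof.
move=> q0 h0; have [n] := ubnP #|X|; elim: n => // n IHn in X Y h0 *.
rewrite ltnS => Xn gen; have [X0|[a aX]] := set_0Vmem X.
  by rewrite X0; apply: h0.
have eX : X = (a |: (X :\ a))%SET by rewrite setD1K.
rewrite eX in gen *; apply: peel_step => //; first by rewrite setD11.
move=> Y' YY'; apply: IHn.
- by move=> Z ZY; apply: h0; apply: subset_trans ZY YY'.
- by move: Xn; rewrite [in #|X|](cardsD1 a) aX.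
- by apply: genericS gen => //; apply: subsetUr.
Qed.

(** The case of empty X follows by symmetry: exchange the alphabets and induct on Y, whose base case
    has both alphabets empty. *)
Lemma peel_identity (T U : finType) (x : T -> E) (y : U -> E)
    (X : {set T}) (Y : {set U}) : q != 0 -> generic x y X Y ->
  peel_sum x y X Y = peel_value x y X Y.
Proof.
move=> q0 gen; apply: (peel_identity_step q0) (gen) => Y' YY'.
have v0 : peel_value x y set0 Y' = 1 by rewrite /peel_value big_set0.
rewrite v0 peel_sumC (peel_identity_step q0).
- by rewrite /peel_value big1 // => j _; rewrite big_set0.
- move=> Z; rewrite subset0 => /eqP->.
  by rewrite peel_sum_set0 /peel_value big_set0.
have [ix iy x0 y0 xy] := genericS (sub0set X) YY' gen; split => //.
by move=> j i; rewrite inE.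
Qed.

End KeyIdentity.

(** * Sums over functions and their level sets *)

Section LevelSums.
Variables (E : fieldType) (q : E).

Section OneAlphabet.
Variable T : finType.
Implicit Types (X I : {set T}) (f : T -> nat).

(** The term of a Hall-Littlewood polynomial attached to one rearrangement f of the exponent vector,
    relative to the alphabet X. *)
Definition hl_summand (x : T -> E) X f : E :=
  \prod_(i in X) x i ^+ f i *
  \prod_(i in X) \prod_(j in X)
    (if (f j < f i)%N then (x i - q * x j) / (x i - x j) else 1).

Definition level_set X f k : {set T} := [set i in X | (k < f i)%N]%SET.

Definition fsupp B (f : {ffun T -> 'I_B.+1}) : {set T} := [set i | (0 < f i)%N]%SET.

Definition level_weight (x : T -> E) X I : E :=
  q ^+ 'C(#|I|, 2) * \prod_(k in X) (if k \in I then x k else 1) *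
  \prod_(i in X) \prod_(k in X)
    (if (i \in I) && (k \notin I) then (x i - q * x k) / (x i - x k) else 1).

(** A function with values at most B + 1 is uniquely the indicator of its support I plus a function
    with values at most B supported in I. *)
Lemma big_fsuppS (R : nmodType) B X (G : (T -> nat) -> R) :
  \sum_(f : {ffun T -> 'I_B.+2} | fsupp f \subset X) G (fun i => f i) =
  \sum_(I : {set T} | I \subset X) \sum_(f : {ffun T -> 'I_B.+1} | fsupp f \subset I)
    G (fun i => (i \in I) + f i)%N.
Proof.
rewrite (partition_big (@fsupp B.+1) (fun I => I \subset X)) //=.
apply: eq_bigr => I IX.
(* The inverse lowers every value by one; off the support the truncated predecessor keeps 0. *)
rewrite (reindex_onto (fun f : {ffun T -> 'I_B.+1} => [ffun i => inord ((i \in I) + f i)]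
                        : {ffun T -> 'I_B.+2})
          (fun f : {ffun T -> 'I_B.+2} => [ffun i => inord (f i).-1]
                        : {ffun T -> 'I_B.+1})) /=; last first.
  move=> f /andP[_ /eqP <-]; apply/ffunP => i; rewrite !ffunE inE; apply: val_inj => /=.
  have lfi := ltn_ord (f i); rewrite [X in (_ + X)%N]inordK ?inordK; lia.
have lt_fI (f : {ffun T -> 'I_B.+1}) i : ((i \in I) + f i < B.+2)%N.
  by have := ltn_ord (f i); case: (i \in I) => /=; lia.
apply: eq_big => [f|f _]; last first.
  by congr G; apply: funext => i; rewrite ffunE inordK.
have suppE : fsupp ([ffun i => inord ((i \in I) + f i)] : {ffun T -> 'I_B.+2}) =
    (I :|: fsupp f)%SET.
  apply/setP => i; rewrite !inE ffunE inordK //; lia.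
rewrite suppE; apply/idP/idP.
  by move=> /andP[/andP[_ /eqP/setUidPl ->]].
move=> sf; rewrite (setUidPl sf) IX eqxx /=; apply/eqP/ffunP => i.
rewrite !ffunE; apply: val_inj => /=; rewrite [X in inord X.-1]inordK //.
have lfi := ltn_ord (f i).
case: (boolP (i \in I)) => iI /=; first by rewrite inordK.
have : i \notin fsupp f by apply: contra iI; apply: (subsetP sf).
by rewrite inE -eqn0Ngt => /eqP ->; rewrite inordK.
Qed.

(** For two indices in I the comparison of values is unchanged by the shift; an index of I beats
    every index outside I; two indices outside I both have value 0 and give no factor. *)
Lemma hl_summand_shift x X I f : I \subset X -> {in ~: I, forall i, f i = 0%N} ->
  hl_summand x X (fun i => (i \in I) + f i)%N =
  \prod_(k in X) (if k \in I then x k else 1) *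
  (\prod_(i in X) \prod_(k in X)
    (if (i \in I) && (k \notin I) then (x i - q * x k) / (x i - x k) else 1)) *
  hl_summand x I f.
Proof.
move=> /subsetP IX f0.
have {}f0 i : i \notin I -> f i = 0%N by move=> iI; apply: f0; rewrite inE.
have restr (F : T -> E) : \prod_(i in I) F i = \prod_(i in X) (if i \in I then F i else 1).
  rewrite -big_mkcondr; apply: eq_bigl => i.
  by case iI : (i \in I); rewrite ?andbF // IX.
rewrite /hl_summand.
set a := \prod_(i in X) _; set b := \prod_(i in X) _.
set c := \prod_(i in X) _; set d := \prod_(i in X) _.
set u := \prod_(i in I) _; set v := \prod_(i in I) _.
have -> : a = c * u.
  rewrite /u restr -big_split /=; apply: eq_bigr => i _.
  case: (boolP (i \in I)) => iI; first by rewrite exprD expr1.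
  by rewrite f0 // expr0 mulr1.
have -> : b = d * v; last by rewrite mulrACA.
rewrite /v restr -big_split /=; apply: eq_bigr => i iX.
rewrite restr; case: (boolP (i \in I)) => iI.
  rewrite -big_split /=; apply: eq_bigr => j jX.
  by case: (boolP (j \in I)) => jI /=; rewrite ?mul1r ?mulr1 // f0.
rewrite mulr1; apply: eq_bigr => j jX; by rewrite (f0 i) // addn0 ltn0.
Qed.

Lemma level_set_shift0 X I f : I \subset X -> {in ~: I, forall i, f i = 0%N} ->
  level_set X (fun i => (i \in I) + f i)%N 0 = I.
Proof.
move=> /subsetP IX f0; apply/setP => i; rewrite !inE.
case: (boolP (i \in I)) => iI /=; first by rewrite IX.
by rewrite f0 ?inE // ltnn andbF.
Qed.

Lemma level_set_shiftS X I f k : I \subset X -> {in ~: I, forall i, f i = 0%N} ->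
  level_set X (fun i => (i \in I) + f i)%N k.+1 = level_set I f k.
Proof.
move=> /subsetP IX f0; apply/setP => i; rewrite !inE.
case: (boolP (i \in I)) => iI /=; first by rewrite IX.
by rewrite f0 ?inE // andbF.
Qed.

End OneAlphabet.

Variables (T U : finType).
Implicit Types (X I : {set T}) (Y J : {set U}).

(** For f and g with values at most B, this is q to the power n(lambda) + n(mu) - <lambda', mu'>,
    read level by level from the conjugate parts. *)
Definition pair_weight B X Y (f : T -> nat) (g : U -> nat) : E :=
  \prod_(k < B) (q ^+ 'C(#|level_set X f k|, 2) * q ^+ 'C(#|level_set Y g k|, 2) /
                 q ^+ (#|level_set X f k| * #|level_set Y g k|)).

Definition pair_sum (x : T -> E) (y : U -> E) B X Y : E :=
  \sum_(f : {ffun T -> 'I_B.+1} | fsupp f \subset X)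
  \sum_(g : {ffun U -> 'I_B.+1} | fsupp g \subset Y)
    pair_weight B X Y (fun i => f i) (fun j => g j) *
    hl_summand x X (fun i => f i) * hl_summand y Y (fun j => g j).

Lemma fsupp_notin (V : finType) B (f : {ffun V -> 'I_B.+1}) (I : {set V}) :
  fsupp f \subset I -> {in ~: I, forall i, f i = 0%N :> nat}.
Proof.
move=> sf i; rewrite inE => iI; apply/eqP; rewrite -leqn0 leqNgt.
by apply: contra iI => fi; rewrite (subsetP sf) // inE.
Qed.

Lemma pair_sumS x y B X Y :
  pair_sum x y B.+1 X Y =
  \sum_(I : {set T} | I \subset X) \sum_(J : {set U} | J \subset Y)
    level_weight x X I * level_weight y Y J / q ^+ (#|I| * #|J|) * pair_sum x y B I J.
Proof.
rewrite /pair_sum (big_fsuppS _ X (fun f => \sum_(g : {ffun U -> 'I_B.+2} | fsupp g \subset Y)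
    pair_weight B.+1 X Y f (fun j => g j) * hl_summand x X f * hl_summand y Y (fun j => g j))).
apply: eq_bigr => I IX.
under eq_bigr => f _ do rewrite (big_fsuppS _ Y (fun g => pair_weight B.+1 X Y _ g *
     hl_summand x X _ * hl_summand y Y g)).
rewrite exchange_big /=; apply: eq_bigr => J JY; rewrite mulr_sumr.
apply: eq_bigr => f /fsupp_notin f0; rewrite mulr_sumr.
apply: eq_bigr => g /fsupp_notin g0.
rewrite !hl_summand_shift // /pair_weight big_ord_recl !level_set_shift0 //.
rewrite (eq_bigr (fun k : 'I_B => q ^+ 'C(#|level_set I (fun i => f i) k|, 2) *
    q ^+ 'C(#|level_set J (fun j => g j) k|, 2) /
    q ^+ (#|level_set I (fun i => f i) k| * #|level_set J (fun j => g j) k|)%N)); last first.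
  by move=> k _; rewrite !lift0 !level_set_shiftS.
rewrite /level_weight; ring.
Qed.

(** Numerator and denominator of the product side are kept apart, so that the error of a truncated
    sum stays a finite expression. *)
Definition prod_num (x : T -> E) (y : U -> E) X Y : E :=
  \prod_(i in X) \prod_(j in Y) (1 - x i * y j).

Definition prod_den (x : T -> E) (y : U -> E) X Y : E :=
  \prod_(i in X) (1 - x i) * \prod_(j in Y) (1 - y j) *
  \prod_(i in X) \prod_(j in Y) (1 - q^-1 * (x i * y j)).

(** The part of [prod_den] that is lost in passing from X, Y to I, J. *)
Definition peel_cofactor (x : T -> E) (y : U -> E) X I Y J : E :=
  \prod_(i in X) (if i \in I then 1 else 1 - x i) *
  \prod_(j in Y) (if j \in J then 1 else 1 - y j) *
  \prod_(i in X) \prod_(j in Y)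
    (if (i \in I) && (j \in J) then 1 else 1 - q^-1 * (x i * y j)).

Section Recursion.
Variables (x : T -> E) (y : U -> E).
Hypothesis q0 : q != 0.

(** The peeling identity multiplied by all the 1 - q^-1 x_i y_j. Those with i in I and j in J turn
    the kernel into q^(-|I||J|) times the numerator for I, J; the others go into the cofactor. *)
Lemma peel_num_sum X Y : generic q x y X Y ->
  prod_num x y X Y =
  \sum_(I : {set T} | I \subset X) \sum_(J : {set U} | J \subset Y)
    level_weight x X I * level_weight y Y J / q ^+ (#|I| * #|J|) *
    peel_cofactor x y X I Y J * prod_num x y I J.
Proof.
move=> gen; have [ix iy x0 y0 xy] := gen.
set L := \prod_(i in X) \prod_(j in Y) (1 - q^-1 * (x i * y j)).
have -> : prod_num x y X Y = peel_value q x y X Y * L.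
  rewrite /prod_num /peel_value /L -big_split /=; apply: eq_bigr => i iX.
  rewrite -big_split /=; apply: eq_bigr => j jY; have := xy _ _ iX jY => ne.
  by field; rewrite ne q0.
rewrite -peel_identity // /peel_sum mulr_suml; apply: eq_bigr => I IX.
rewrite mulr_suml; apply: eq_bigr => J JY.
rewrite /peel_weight /level_weight /peel_cofactor /peel_kernel.
have split1 (V : finType) (z : V -> E) (Z K : {set V}) :
    \prod_(k in Z) (if k \in K then z k else 1 - z k) =
    \prod_(k in Z) (if k \in K then z k else 1) *
    \prod_(k in Z) (if k \in K then 1 else 1 - z k).
  by rewrite -big_split /=; apply: eq_bigr => k _; case: (k \in K); rewrite ?mulr1 ?mul1r.
rewrite !split1.
have restr (V : finType) (Z K : {set V}) (F : V -> E) : K \subset Z ->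
    \prod_(i in K) F i = \prod_(i in Z) (if i \in K then F i else 1).
  move=> /subsetP KZ; rewrite -big_mkcondr; apply: eq_bigl => i.
  by case iK : (i \in K); rewrite ?andbF // KZ.
set K := \prod_(i in X) \prod_(j in Y) (if _ then _ / _ else 1).
set M := \prod_(i in X) \prod_(j in Y) (if _ then 1 else _).
have e : K * L = M * prod_num x y I J / q ^+ (#|I| * #|J|).
  rewrite [(#|I| * #|J|)%N]mulnC exprM -prodr_const /prod_num.
  rewrite -mulrA -prodf_div (restr _ X) // -!big_split /=; apply: eq_bigr => i iX.
  case: (boolP (i \in I)) => iI /=; last first.
    by rewrite mulr1 -big_split /=; apply: eq_bigr => j _; rewrite mul1r.
  rewrite -prodr_const -prodf_div (restr _ Y) // -!big_split /=; apply: eq_bigr => j jY.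
  have ne := xy _ _ iX jY; case: ifP => _; last by rewrite mul1r mulr1.
  by field; rewrite ne q0.
rewrite -mulrA e; ring.
Qed.

Lemma peel_den X I Y J : I \subset X -> J \subset Y ->
  prod_den x y X Y = peel_cofactor x y X I Y J * prod_den x y I J.
Proof.
move=> IX JY; rewrite /prod_den /peel_cofactor.
have restr (V : finType) (Z K : {set V}) (F : V -> E) : K \subset Z ->
    \prod_(i in K) F i = \prod_(i in Z) (if i \in K then F i else 1).
  move=> /subsetP KZ; rewrite -big_mkcondr; apply: eq_bigl => i.
  by case iK : (i \in K); rewrite ?andbF // KZ.
rewrite (restr _ X I) // (restr _ Y J) //.
have mulif (b : bool) (u : E) : u = (if b then 1 else u) * (if b then u else 1).
  by case: b; rewrite ?mulr1 ?mul1r.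
have -> : \prod_(i in X) (1 - x i) = \prod_(i in X) (if i \in I then 1 else 1 - x i) *
    \prod_(i in X) (if i \in I then 1 - x i else 1).
  by rewrite -big_split /=; apply: eq_bigr => i _; apply: mulif.
have -> : \prod_(i in Y) (1 - y i) = \prod_(i in Y) (if i \in J then 1 else 1 - y i) *
    \prod_(i in Y) (if i \in J then 1 - y i else 1).
  by rewrite -big_split /=; apply: eq_bigr => i _; apply: mulif.
have -> : \prod_(i in X) \prod_(j in Y) (1 - q^-1 * (x i * y j)) =
    \prod_(i in X) \prod_(j in Y)
      (if (i \in I) && (j \in J) then 1 else 1 - q^-1 * (x i * y j)) *
    \prod_(i in I) \prod_(j in J) (1 - q^-1 * (x i * y j)).
  rewrite (restr _ X I) // -big_split; apply: eq_bigr => i iX /=.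
  case: (boolP (i \in I)) => iI /=; last by rewrite mulr1.
  by rewrite (restr _ Y J) // -big_split /=; apply: eq_bigr => j _; apply: mulif.
ring.
Qed.

(** The numerator and the truncated sum obey the same recursion, and the denominator contributes the
    same cofactor to both; subtract term by term. *)
Lemma pair_sum_defect B X Y : generic q x y X Y ->
  prod_num x y X Y - prod_den x y X Y * pair_sum x y B.+1 X Y =
  \sum_(I : {set T} | I \subset X) \sum_(J : {set U} | J \subset Y)
    level_weight x X I * level_weight y Y J / q ^+ (#|I| * #|J|) *
    peel_cofactor x y X I Y J *
    (prod_num x y I J - prod_den x y I J * pair_sum x y B I J).
Proof.
move=> gen; rewrite (peel_num_sum gen) pair_sumS mulr_sumr -sumrB.
apply: eq_bigr => I IX; rewrite mulr_sumr -sumrB; apply: eq_bigr => J JY.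
rewrite (peel_den IX JY); ring.
Qed.

Lemma pair_sum_set0 B : pair_sum x y B set0 set0 = 1.
Proof.
rewrite /pair_sum (big_pred1 [ffun=> ord0]) => [|f]; last first.
  rewrite subset0; apply/eqP/eqP => [f0|->]; last first.
    by apply/setP => i; rewrite !inE ffunE.
  apply/ffunP => i; rewrite ffunE; apply: val_inj => /=.
  by apply: (@fsupp_notin _ _ f set0); rewrite ?f0 ?inE.
rewrite (big_pred1 [ffun=> ord0]) => [|f]; last first.
  rewrite subset0; apply/eqP/eqP => [f0|->]; last first.
    by apply/setP => i; rewrite !inE ffunE.
  apply/ffunP => i; rewrite ffunE; apply: val_inj => /=.
  by apply: (@fsupp_notin _ _ f set0); rewrite ?f0 ?inE.
rewrite /hl_summand !big_set0 !mulr1 /pair_weight big1 // => k _.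
have lev0 (V : finType) (f : V -> nat) j : level_set set0 f j = set0.
  by apply/setP => i; rewrite !inE.
by rewrite !lev0 !cards0 !expr0 mulr1 divr1.
Qed.

End Recursion.
End LevelSums.

(** * The degree filtration on rational functions *)

Section MinDegree.
Variables (F : fieldType) (n : nat).
Local Notation A := {mpoly F[n]}.
Local Notation E := {fraction A}.
Implicit Types (p h : A) (z w : E) (k : nat).

Definition mord k p := {in msupp p, forall m, (k <= mdeg m)%N}.

Lemma mord0 k : mord k 0.
Proof. by move=> m; rewrite msupp0. Qed.

Lemma mordW k l p : (l <= k)%N -> mord k p -> mord l p.
Proof. by move=> lk hp m /hp; apply: leq_trans. Qed.

Lemma mordD k p1 p2 : mord k p1 -> mord k p2 -> mord k (p1 + p2).
Proof. by move=> h1 h2 m /msuppD_le; rewrite mem_cat => /orP[/h1|/h2]. Qed.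

Lemma mordM k1 k2 p1 p2 : mord k1 p1 -> mord k2 p2 -> mord (k1 + k2) (p1 * p2).
Proof.
move=> h1 h2 m /msuppM_le /allpairsP[[m1 m2] [/= /h1 l1 /h2 l2 ->]].
by rewrite mdegD leq_add.
Qed.

Lemma mord_homog d p : p \is d.-homog -> mord d p.
Proof. by move=> /dhomogP hp m /hp /= <-. Qed.

Lemma pihomogM_homog d e h p : h \is e.-homog ->
  pihomog mdeg (e + d) (h * p) = h * pihomog mdeg d p.
Proof.
move=> hh; have [K sK] : exists K, (msize p <= K)%N by exists (msize p).
rewrite {1}(pihomog_partitionE sK) mulr_sumr raddf_sum /=.
have term i : pihomog mdeg (e + d) (h * pihomog mdeg i p) =
    if i == d then h * pihomog mdeg i p else 0.
  have hi : h * pihomog mdeg i p \is (e + i).-homog by rewrite dhomogM // pihomogP.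
  case: eqP => [<-|/eqP ne]; first by rewrite pihomog_dE.
  by rewrite (pihomog_ne0 _ hi) // eqn_add2l.
rewrite {2}(pihomog_partitionE sK) [in RHS]raddf_sum /= mulr_sumr.
apply: eq_bigr => i _; rewrite term; case: eqP => [->|/eqP ne].
  by rewrite pihomog_id.
by rewrite (pihomog_ne0 ne) ?mulr0 // pihomogP.
Qed.

Lemma mord_pihomog k p : mord k p <-> (forall d, (d < k)%N -> pihomog mdeg d p = 0).
Proof.
split=> h.
  move=> d dk; rewrite pihomogE big_seq_cond big1 // => m /andP[/h km /eqP dm].
  by move: dk; rewrite -dm ltnNge km.
move=> m mp; rewrite leqNgt; apply/negP => /h e.
have : p@_m != 0 by rewrite mpoly.mcoeff_eq0 negbK.
have sK : (msize p <= msize p)%N by [].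
rewrite {1}(pihomog_partitionE sK) raddf_sum /= big1 ?eqxx // => i _.
have [->|ne] := eqVneq (i : nat) (mdeg m); first by rewrite e mcoeff0.
by rewrite (dhomog_nemf_coeff (pihomogP _ _ _)) // eq_sym.
Qed.

(** The component of h p in degree e + d is h times the component of p in degree d, and there are no
    zero divisors. *)
Lemma mord_cancel k e h p : h != 0 -> h \is e.-homog -> mord (e + k) (h * p) -> mord k p.
Proof.
move=> h0 hh /mord_pihomog hp; apply/mord_pihomog => d dk.
have /eqP := hp (e + d)%N (etrans (ltn_add2l _ _ _) dk).
by rewrite pihomogM_homog // mulf_eq0 (negbTE h0) => /eqP.
Qed.

(** Order at least k for a rational function with homogeneous denominator. Such denominators suffice
    for the x_i - x_j, and they make the order behave as it does on polynomials. *)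
Definition ford k z := exists p h e,
  [/\ h != 0, h \is e.-homog, mord (e + k) p & z = tofrac p / tofrac h].

(** By [mord_cancel] a bound does not depend on the fraction chosen; this brings estimates made in
    the fraction field back to polynomials. *)
Lemma ford_tofrac k p : ford k (tofrac p) <-> mord k p.
Proof.
split=> [[r [h [e [h0 hh hr]]]]|hp]; last first.
  exists p, 1, 0%N; split; rewrite ?oner_neq0 ?dhomog1 //.
  by rewrite tofrac1 divr1.
move=> /eqP; rewrite -[tofrac p]divr1 -tofrac1.
rewrite eqr_div ?tofrac_eq0 ?oner_neq0 // -!tofracM tofrac_eq mulr1 mulrC => /eqP e1.
by apply: (mord_cancel h0 hh); rewrite e1.
Qed.

Lemma ford0 k : ford k 0.
Proof. by rewrite -tofrac0; apply/ford_tofrac/mord0. Qed.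

Lemma ford1 : ford 0 1.
Proof. by rewrite -tofrac1; apply/ford_tofrac. Qed.

Lemma fordW k l z : (l <= k)%N -> ford k z -> ford l z.
Proof.
move=> lk [p [h [e [h0 hh hp ->]]]]; exists p, h, e; split => //.
by apply: mordW hp; rewrite leq_add2l.
Qed.

Lemma fordM k1 k2 z1 z2 : ford k1 z1 -> ford k2 z2 -> ford (k1 + k2) (z1 * z2).
Proof.
move=> [p1 [h1 [e1 [h10 hh1 hp1 ->]]]] [p2 [h2 [e2 [h20 hh2 hp2 ->]]]].
exists (p1 * p2), (h1 * h2), (e1 + e2)%N; split.
- by rewrite mulf_neq0.
- exact: dhomogM.
- by rewrite addnACA; apply: mordM.
- by rewrite mulf_div !tofracM.
Qed.

Lemma fordD k z1 z2 : ford k z1 -> ford k z2 -> ford k (z1 + z2).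
Proof.
move=> [p1 [h1 [e1 [h10 hh1 hp1 ->]]]] [p2 [h2 [e2 [h20 hh2 hp2 ->]]]].
exists (p1 * h2 + p2 * h1), (h1 * h2), (e1 + e2)%N; split.
- by rewrite mulf_neq0.
- exact: dhomogM.
- apply: mordD.
    by rewrite addnAC; apply: mordM hp1 (mord_homog hh2).
  by rewrite [(e1 + e2)%N]addnC addnAC; apply: mordM hp2 (mord_homog hh1).
- by rewrite addf_div ?tofrac_eq0 // !(tofracM, tofracD).
Qed.

Lemma fordN k z : ford k z -> ford k (- z).
Proof.
move=> hz; rewrite -mulN1r -[k]add0n; apply: fordM hz.
by rewrite -tofrac1 -tofracN; apply/ford_tofrac.
Qed.

Lemma ford_sum (I : Type) (r : seq I) (P : pred I) (G : I -> E) k :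
  (forall i, P i -> ford k (G i)) -> ford k (\sum_(i <- r | P i) G i).
Proof.
move=> h; elim/big_ind: _ => // [|z1 z2]; [exact: ford0|exact: fordD].
Qed.

Lemma ford_prod (I : Type) (r : seq I) (P : pred I) (G : I -> E) (k : I -> nat) :
  (forall i, P i -> ford (k i) (G i)) ->
  ford (\sum_(i <- r | P i) k i) (\prod_(i <- r | P i) G i).
Proof.
move=> h; elim/big_rec2: _ => [|i m z Pi hz]; first exact: ford1.
by apply: fordM => //; apply: h.
Qed.

Lemma ford_prod0 (I : Type) (r : seq I) (P : pred I) (G : I -> E) :
  (forall i, P i -> ford 0 (G i)) -> ford 0 (\prod_(i <- r | P i) G i).
Proof. by move=> h; have := ford_prod r h; rewrite big1_eq. Qed.

Lemma fordX k z a : ford k z -> ford (k * a) (z ^+ a).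
Proof.
move=> hz; elim: a => [|a IH]; first by rewrite muln0; apply: ford1.
by rewrite mulnS exprS; apply: fordM.
Qed.

Variable q : F.
Local Notation Q := (tofrac q%:MP_[n] : E).

Lemma ford_const (c : F) : ford 0 (tofrac c%:MP_[n]).
Proof. exact/ford_tofrac. Qed.

Section Alphabet.
Variables (T : finType) (v : T -> 'I_n).
Hypothesis v_inj : injective v.
Let x (i : T) : E := tofrac 'X_(v i).

Lemma ford_var i : ford 1 (x i).
Proof. by apply/ford_tofrac/mord_homog; rewrite dhomogX /= mdeg1. Qed.

Lemma ford_cross i j : ford 0 ((x i - Q * x j) / (x i - x j)).
Proof.
(* For i = j the denominator is 0 and the quotient is 0 by convention. *)
have [->|ne] := eqVneq i j; first by rewrite subrr invr0 mulr0; apply: ford0.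
exists ('X_(v i) - q%:MP * 'X_(v j)), ('X_(v i) - 'X_(v j)), 1%N.
have hom (l : T) : ('X_(v l) : A) \is 1.-homog by rewrite dhomogX /= mdeg1.
split.
- apply/eqP => /(congr1 (mcoeff U_(v i)%MM)).
  rewrite mcoeffB !mcoeffXU mcoeff0 eqxx (inj_eq v_inj) eq_sym (negbTE ne) subr0.
  by apply/eqP; rewrite oner_eq0.
- by rewrite rpredB.
- by apply: mord_homog; rewrite rpredB ?hom // mul_mpolyC rpredZ ?hom.
- by rewrite !tofracB tofracM.
Qed.

Lemma ford_summand (X : {set T}) (f : T -> nat) :
  ford (\sum_(i in X) f i) (hl_summand Q x X f).
Proof.
rewrite -[(\sum_(i in X) _)%N]addn0; apply: fordM.
  by apply: ford_prod => i _; have := fordX (f i) (ford_var i); rewrite mul1n.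
apply: ford_prod0 => i _; apply: ford_prod0 => j _; case: ifP => _.
  exact: ford_cross.
exact: ford1.
Qed.

Lemma ford_level_weight (X I : {set T}) : I \subset X ->
  ford #|I| (level_weight Q x X I).
Proof.
move=> IX; rewrite -[#|I|]addn0 -[#|I|]add0n; apply: fordM; first apply: fordM.
- exact: (@fordX 0 _ _ (ford_const _)).
- rewrite (_ : #|I| = \sum_(k in X) (k \in I))%N.
    by apply: ford_prod => k _; case: ifP => _; [exact: ford_var|exact: ford1].
  rewrite -sum1_card big_mkcond [RHS]big_mkcond; apply: eq_bigr => k _.
  by case kI : (k \in I); rewrite ?(subsetP IX _ kI) //; case: ifP.
apply: ford_prod0 => i _; apply: ford_prod0 => j _; case: ifP => _.
  exact: ford_cross.
exact: ford1.
Qed.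

End Alphabet.

Section Defect.
Variables (T U : finType) (v : T -> 'I_n) (w : U -> 'I_n).
Hypotheses (v_inj : injective v) (w_inj : injective w).
Hypothesis q0 : q != 0.
Let x (i : T) : E := tofrac 'X_(v i).
Let y (j : U) : E := tofrac 'X_(w j).

Let Q0 : Q != 0.
Proof. by rewrite tofrac_eq0 mpolyC_eq0. Qed.

Let QV : Q^-1 = tofrac q^-1%:MP_[n].
Proof.
apply: (mulfI Q0); rewrite divff // -tofracM -mpolyCM divff //.
Qed.

Let tofrac_var_inj : injective (fun i : 'I_n => tofrac ('X_i : A)).
Proof.
move=> i j /eqP; rewrite tofrac_eq => /eqP/(congr1 (mcoeff U_(i)%MM)).
rewrite !mcoeffXU eqxx; case: eqP => // _ /eqP.
by rewrite oner_eq0.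
Qed.

Lemma generic_vars X Y : generic Q x y X Y.
Proof.
have var0 (i : 'I_n) : tofrac ('X_i : A) != 0.
  rewrite tofrac_eq0; apply/eqP => /(congr1 (mcoeff U_(i)%MM))/eqP.
  by rewrite mcoeffXU eqxx mcoeff0 oner_eq0.
split.
- by move=> i j _ _ /tofrac_var_inj/v_inj.
- by move=> i j _ _ /tofrac_var_inj/w_inj.
- by move=> i _; apply: var0.
- by move=> j _; apply: var0.
move=> i j _ _.
(* The constant coefficient of q - x_i y_j is q, which is nonzero. *)
rewrite -tofracM -tofracB tofrac_eq0; apply/eqP => /(congr1 (mcoeff 0%MM))/eqP.
rewrite mcoeffB mcoeffC eqxx mulr1 mcoeff0 -mpolyXD mcoeffX.
by rewrite -mdeg_eq0 mdegD !mdeg1 subr0 (negbTE q0).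
Qed.

(** Induction on B through the recursion for the defect. For B = 0 only the absence of negative
    order is claimed. *)
Lemma ford_defect B X Y :
  ford B (prod_num x y X Y - prod_den Q x y X Y * pair_sum Q x y B X Y).
Proof.
have polyD z1 z2 : ford 0 z1 -> ford 0 z2 -> ford 0 (z1 - z2).
  by move=> h1 h2; apply: fordD h1 (fordN h2).
have f1x i : ford 0 (1 - x i).
  by apply: polyD ford1 _; apply: fordW (ford_var _ _).
have f1y i : ford 0 (1 - y i).
  by apply: polyD ford1 _; apply: fordW (ford_var _ _).
have fxy i j : ford 0 (x i * y j).
  by apply: (@fordW 2) => //; apply: (@fordM 1 1); apply: ford_var.
have fQ : ford 0 Q^-1 by rewrite QV; apply: ford_const.
have fqxy i j : ford 0 (1 - Q^-1 * (x i * y j)).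
  by apply: polyD ford1 _; apply: (@fordM 0 0).
have fnum Z W : ford 0 (prod_num x y Z W).
  by apply: ford_prod0 => i _; apply: ford_prod0 => j _; apply: polyD ford1 _.
elim: B X Y => [|B IH] X Y.
  apply: polyD => //; apply: (@fordM 0 0).
    apply: (@fordM 0 0); last by do 2!apply: ford_prod0 => ? _.
    by apply: (@fordM 0 0); apply: ford_prod0 => i _; [apply: f1x | apply: f1y].
  apply: ford_sum => f _; apply: ford_sum => g _.
  apply: (@fordM 0 0); last exact: fordW (ford_summand _ _ _).
  apply: (@fordM 0 0); last exact: fordW (ford_summand _ _ _).
  by rewrite /pair_weight big_ord0; apply: ford1.
rewrite pair_sum_defect //; last exact: generic_vars.
apply: ford_sum => I IX; apply: ford_sum => J JY.
(* The recursion returns to empty alphabets here, where the truncated sum is 1 and the defect is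
   exactly zero. *)
have [IJ0|IJ] := posnP (#|I| + #|J|)%N.
  move/eqP: IJ0; rewrite addn_eq0 !cards_eq0 => /andP[/eqP-> /eqP->].
  rewrite pair_sum_set0 /prod_num /prod_den !big_set0 !mulr1 subrr mulr0.
  exact: ford0.
(* The degree |I| + |J| >= 1 of the two level weights pays for the step from B to B + 1. *)
apply: (@fordW (#|I| + #|J| + B)); first by rewrite -addn1 addnC leq_add2r.
apply: fordM; last exact: IH.
rewrite -[(_ + _)%N]addn0; apply: fordM.
  rewrite -[(_ + _)%N]addn0; apply: fordM.
    by apply: fordM; apply: ford_level_weight.
  by rewrite -exprVn; apply: (@fordX 0).
apply: (@fordM 0 0); last first.
  apply: ford_prod0 => i _; apply: ford_prod0 => j _; case: ifP => _ //.
  exact: ford1.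
apply: (@fordM 0 0); apply: ford_prod0 => k _; case: ifP => _;
  [exact: ford1|exact: f1x|exact: ford1|exact: f1y].
Qed.

End Defect.
End MinDegree.

(** * Polynomiality of Hall-Littlewood functions *)

Section Polynomiality.
Variables (F : fieldType) (n : nat).
Local Notation A := {mpoly F[n]}.
Local Notation E := {fraction A}.

(** Substitutions congruent modulo [l] on the variables are congruent on all polynomials. With the
    identity as one of them, a polynomial killed by the other is divisible by [l]. *)
Lemma comp_mpoly_congr (l : A) (t u : n.-tuple A) :
  (forall i, exists g, tnth t i - tnth u i = l * g) ->
  forall p : A, exists g, (p \mPo t) - (p \mPo u) = l * g.
Proof.
move=> tu.
have congrM (a b c d : A) : (exists g, a - b = l * g) -> (exists g, c - d = l * g) ->
    exists g, a * c - b * d = l * g.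
  move=> [g ab] [h cd]; exists (g * c + b * h).
  have -> : a = b + l * g by rewrite -ab addrC subrK.
  by rewrite mulrDr !mulrA [l * g * _]mulrC -[l * b]mulrC -mulrA -cd; ring.
have congr_refl (a : A) : exists g, a - a = l * g.
  by exists 0; rewrite subrr mulr0.
have congrX (a b : A) k : (exists g, a - b = l * g) -> exists g, a ^+ k - b ^+ k = l * g.
  move=> ab; elim: k => [|k IH]; first by rewrite !expr0; apply: congr_refl.
  by rewrite !exprS; apply: congrM.
elim/mpolyind => [|c m p _ _ [g IH]]; first by rewrite !comp_mpoly0; apply: congr_refl.
have [h hm] : exists g, ('X_[m] \mPo t) - ('X_[m] \mPo u) = l * g.
  rewrite !comp_mpolyX; elim/big_rec2: _ => [|i a b _ ab]; first exact: congr_refl.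
  exact: congrM (congrX _ _ _ (tu i)) ab.
exists (c *: h + g); rewrite !comp_mpolyD !comp_mpolyZ opprD addrACA IH.
by rewrite -scalerBr hm mulrDr scalerAr.
Qed.

Lemma common_den_sum (I : finType) (d : A) (R : pred I) (g : I -> E) :
  (forall f, R f -> exists r : A, tofrac d * g f = tofrac r) ->
  exists r : A, tofrac d * \sum_(f | R f) g f = tofrac r.
Proof.
move=> hR; elim/big_rec: _ => [|f z Rf [r hr]]; first by exists 0; rewrite mulr0 tofrac0.
by have [r' hr'] := hR _ Rf; exists (r' + r); rewrite mulrDr hr hr' tofracD.
Qed.

(** Linear factors of the denominator are removed one at a time: a second denominator h, not
    vanishing on the hyperplane of the factor, forces the numerator to vanish there. *)
Lemma pole_removal (z : E) (s : seq ('I_n * 'I_n)) :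
  (exists p, tofrac (\prod_(e <- s) ('X_(e.1) - 'X_(e.2)) : A) * z = tofrac p) ->
  (forall e, e \in s -> e.1 != e.2 /\
    exists h r : A, tofrac h * z = tofrac r /\
      (h \mPo [tuple (if k == e.1 then 'X_(e.2) else 'X_k : A) | k < n]) != 0) ->
  exists p, z = tofrac p.
Proof.
elim: s => [|e s IH] [p hp] hs; first by exists p; rewrite -hp big_nil tofrac1 mul1r.
apply: IH => [|e' es]; last by apply: hs; rewrite inE es orbT.
have [ne [h [r [hz h0]]]] := hs e (mem_head _ _).
set W : A := \prod_(e <- s) _; set l : A := 'X_(e.1) - 'X_(e.2).
move: hp; rewrite big_cons -/W -/l tofracM -mulrA => hp.
have l0 : l != 0.
  apply/eqP => /(congr1 (mcoeff U_(e.1)%MM)) /eqP.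
  by rewrite mcoeffB !mcoeffXU mcoeff0 eqxx [e.2 == _]eq_sym (negbTE ne) subr0 oner_eq0.
have hpl : h * p = l * (W * r).
  apply/eqP; rewrite -tofrac_eq !tofracM -hp -hz; apply/eqP; ring.
set t := [tuple _ | k < n] in h0.
have lt : l \mPo t = 0.
  rewrite /l comp_mpolyB !comp_mpolyXU -!tnth_nth !tnth_mktuple eqxx.
  by rewrite eq_sym (negbTE ne) subrr.
(* On the hyperplane the right side of [hpl] is zero and h is not, so p is zero. *)
have pt : p \mPo t = 0.
  have /eqP := congr1 (fun p => p \mPo t) hpl.
  by rewrite !rmorphM /= lt mul0r mulf_eq0 (negbTE h0) => /eqP.
have [|g hg] := @comp_mpoly_congr l [tuple 'X_k | k < n] t _ p.
  move=> i; rewrite !tnth_mktuple; case: eqP => [->|_]; first by exists 1; rewrite mulr1.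
  by exists 0; rewrite subrr mulr0.
exists g; apply: (@mulfI _ (tofrac l)); first by rewrite tofrac_eq0.
rewrite hp -tofracM -hg pt subr0 comp_mpoly_id //.
Qed.

End Polynomiality.

Lemma hl_summand_pairs (E : fieldType) (Q : E) (T : finType) (x : T -> E) (f : T -> nat) :
  hl_summand Q x setT f =
  \prod_i x i ^+ f i * \prod_(e : T * T | e.1 != e.2)
    (if (f e.2 < f e.1)%N then (x e.1 - Q * x e.2) / (x e.1 - x e.2) else 1).
Proof.
rewrite /hl_summand pair_big /=; congr (_ * _).
  by apply: eq_bigl => i; rewrite inE.
rewrite (bigID (fun e : T * T => e.1 != e.2)) /= [X in _ * X]big1 ?mulr1.
  by apply: eq_bigl => e; rewrite !inE.
by move=> e /andP[_ /negPn/eqP->]; rewrite ltnn.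
Qed.

Lemma tofrac_varB_neq0 (F : fieldType) n (i j : 'I_n) : i != j ->
  tofrac ('X_i : mpoly n F) - tofrac 'X_j != 0.
Proof.
move=> ne; rewrite -tofracB tofrac_eq0; apply/eqP => /(congr1 (mcoeff U_(i)%MM)) /eqP.
by rewrite mcoeffB !mcoeffXU mcoeff0 eqxx [j == _]eq_sym (negbTE ne) subr0 oner_eq0.
Qed.

Section CommonDenominator.
Variables (F : fieldType) (q : F) (n N : nat) (v : 'I_n -> 'I_N).
Local Notation A := {mpoly F[N]}.

(** Each pair occurs in both orders, so no ordering of the variables has to be chosen. The map [v]
    lets the same formula serve a single alphabet and either alphabet inside the joint one. *)
Definition pair_den : A := \prod_(e : 'I_n * 'I_n | e.1 != e.2) ('X_(v e.1) - 'X_(v e.2)).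

Definition pair_num (f : 'I_n -> nat) : A :=
  \prod_(i < n) 'X_(v i) ^+ f i * \prod_(e : 'I_n * 'I_n | e.1 != e.2)
  (if (f e.2 < f e.1)%N then 'X_(v e.1) - q%:MP * 'X_(v e.2)
   else 'X_(v e.1) - 'X_(v e.2)).

Hypothesis v_inj : injective v.

Lemma pair_den_summand f :
  tofrac pair_den * hl_summand (tofrac q%:MP) (fun i => tofrac 'X_(v i)) setT f =
  tofrac (pair_num f).
Proof.
rewrite hl_summand_pairs /pair_den /pair_num tofracM mulrCA !rmorph_prod /=; congr (_ * _).
  by apply: eq_bigr => i _; rewrite rmorphXn.
rewrite -big_split /=; apply: eq_bigr => e; rewrite -(inj_eq v_inj) => /(@tofrac_varB_neq0 F) ne.
case: ifP => _; last by rewrite mulr1.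
by rewrite !tofracB tofracM mulrC divfK.
Qed.

Lemma pair_den_neq0 : pair_den != 0.
Proof.
apply/prodf_neq0 => e; rewrite -(inj_eq v_inj) => /(@tofrac_varB_neq0 F).
by rewrite -tofracB tofrac_eq0.
Qed.

End CommonDenominator.

Section PairSwap.
Variables (F : fieldType) (n : nat) (q : F) (B : nat).
Local Notation A := {mpoly F[n]}.
Local Notation E := {fraction A}.
Local Notation Q := (tofrac q%:MP_[n] : E).
Local Notation x := (fun i : 'I_n => tofrac ('X_i : A)).
Implicit Types f : {ffun 'I_n -> 'I_B.+1}.

Let fac f (e : 'I_n * 'I_n) : E :=
  if (f e.2 < f e.1)%N then (x e.1 - Q * x e.2) / (x e.1 - x e.2) else 1.

Section OnePair.
Variables (i j : 'I_n).
Hypothesis ij : i != j.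

Let other (e : 'I_n * 'I_n) := [&& e.1 != e.2, e != (i, j) & e != (j, i)].

Let h : A := \prod_(e | other e) ('X_(e.1) - 'X_(e.2)).

Let v f : A := \prod_(k < n) 'X_k ^+ f k * \prod_(e | other e)
  (if (f e.2 < f e.1)%N then 'X_(e.1) - q%:MP * 'X_(e.2) else 'X_(e.1) - 'X_(e.2)).

Let h_summand f : tofrac h * hl_summand Q x setT (fun i => f i) =
  tofrac (v f) * (fac f (i, j) * fac f (j, i)).
Proof.
have -> : hl_summand Q x setT (fun i => f i) =
  \prod_(k < n) x k ^+ f k * \prod_(e : 'I_n * 'I_n | e.1 != e.2) fac f e.
  exact: hl_summand_pairs.
rewrite (bigD1 (i, j)) //= (bigD1 (j, i)) /=; last first.
  by rewrite eq_sym ij /= xpair_eqE negb_and eq_sym ij.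
rewrite (eq_bigl other); last by move=> e; rewrite /other andbA.
rewrite /v tofracM !rmorph_prod /=.
have -> : \prod_(k < n) tofrac ('X_k ^+ f k : A) = \prod_(k < n) x k ^+ f k.
  by apply: eq_bigr => k _; rewrite rmorphXn.
set X := \prod_(k < n) _; set H := \prod_(e | other e) _.
set G := \prod_(e | other e) _; set V := \prod_(e | other e) _.
have e : H * G = V; last by rewrite -e; ring.
rewrite -big_split /=; apply: eq_bigr => e /and3P[/(@tofrac_varB_neq0 F) ne _ _].
rewrite /fac; case: ifP => _; last by rewrite mulr1.
by rewrite !tofracB tofracM mulrC divfK.
Qed.

Let s := tperm i j.
Let st := [tuple ('X_(s k) : A) | k < n].
Let sf f : {ffun 'I_n -> 'I_B.+1} := [ffun k => f (s k)].

Let st_X k : 'X_k \mPo st = 'X_(s k).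
Proof. by rewrite comp_mpolyXU -tnth_nth tnth_mktuple. Qed.

Let v_swap f : v f \mPo st = v (sf f).
Proof.
rewrite /v rmorphM !rmorph_prod /=; congr (_ * _).
  rewrite (reindex_inj (@perm_inj _ s)) /=; apply: eq_bigr => k _.
  by rewrite rmorphXn /= st_X ffunE tpermK.
rewrite (reindex_inj (h := fun e => (s e.1, s e.2))) /=; last first.
  by move=> [a b] [c d] [/perm_inj -> /perm_inj ->].
apply: eq_big => [[a b]|[a b] _] /=.
  have si k : (s k == i) = (k == j) by rewrite -{1}(tpermR i j) (inj_eq perm_inj).
  have sj k : (s k == j) = (k == i) by rewrite -{1}(tpermL i j) (inj_eq perm_inj).
  by rewrite /other /= !xpair_eqE !si !sj (inj_eq perm_inj); congr (_ && _); rewrite andbC.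
rewrite !ffunE; case: ifP => _; rewrite rmorphB ?rmorphM /= ?comp_mpolyC !st_X ?tpermK //.
Qed.

(** No pole along x_i = x_j. Functions with f i = f j have no such factor; the others are matched
    with their swap, and the two fractions combine to the difference of a polynomial and its swap
    over x_i - x_j. *)
Lemma pair_regular (P : pred {ffun 'I_n -> 'I_B.+1}) :
  (forall f, P (sf f) = P f) ->
  exists r : A, tofrac h *
    (\sum_(f | P f) hl_summand Q x setT (fun i => f i)) = tofrac r.
Proof.
move=> Ps; set t := fun f => hl_summand Q x setT (fun i => f i).
have sfK f : sf (sf f) = f by apply/ffunP => k; rewrite !ffunE tpermK.
have diag f : f i = f j -> tofrac h * t f = tofrac (v f).
  by move=> e; rewrite h_summand /fac /= e ltnn !mulr1.
pose l : A := 'X_i - 'X_j.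
have l0 : tofrac l != 0 by rewrite tofracB tofrac_varB_neq0.
have offdiag f : (f j < f i)%N -> exists r : A, tofrac h * (t f + t (sf f)) = tofrac r.
  move=> fij; pose u := v f * ('X_i - q%:MP * 'X_j).
  have hf : tofrac h * t f = tofrac u / tofrac l.
    rewrite h_summand /fac /= fij ltnNge (ltnW fij) /= mulr1 /u /l.
    by move: (v f) => V; rewrite !(tofracM, tofracB) mulrA.
  have uE : u \mPo st = v (sf f) * ('X_j - q%:MP * 'X_i).
    rewrite /u rmorphM /= v_swap rmorphB rmorphM /=; congr (_ * _).
    by rewrite comp_mpolyC !st_X /s tpermL tpermR.
  have hsf : tofrac h * t (sf f) = - (tofrac (u \mPo st) / tofrac l).
    rewrite h_summand /fac /= !ffunE tpermL tpermR fij ltnNge (ltnW fij) /= mul1r.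
    rewrite uE.
    have -> : tofrac 'X_j - tofrac 'X_i = - tofrac l by rewrite /l tofracB opprB.
    move: (v (sf f)) (tofrac l) => V L.
    by rewrite !(tofracM, tofracB) invrN !mulrN mulrA.
  (* Exchanging x_i and x_j is the identity modulo [l], so [l] divides u minus its swap. *)
  have [k|r hr] := @comp_mpoly_congr F n l [tuple 'X_k | k < n] st _ u.
    rewrite !tnth_mktuple /s; case: tpermP => [->|->|_ _]; first by exists 1; rewrite mulr1.
      by exists (-1); rewrite mulrN1 opprB.
    by exists 0; rewrite subrr mulr0.
  exists r; rewrite mulrDr hf hsf -mulrBl -tofracB -[u in u - _]comp_mpoly_id hr.
  by rewrite tofracM mulrC mulKf.
have -> : \sum_(f | P f) t f = \sum_(f | P f && (f i == f j)) t f +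
    \sum_(f | P f && (f j < f i)%N) (t f + t (sf f)).
  rewrite (bigID (fun f => f i == f j)) /=; congr (_ + _).
  rewrite (bigID (fun f => f j < f i)%N) big_split /=; congr (_ + _).
    by apply: eq_bigl => f; rewrite -andbA; congr (_ && _); rewrite -val_eqE /=; lia.
  rewrite (reindex_inj (can_inj sfK)) /=; apply: eq_bigl => f.
  rewrite Ps !ffunE tpermL tpermR -andbA; congr (_ && _).
  by rewrite -val_eqE /=; lia.
have [r1 hr1] := common_den_sum (R := fun f => P f && (f i == f j)) (g := t)
  (fun f h => ex_intro _ _ (diag f (eqP (proj2 (andP h))))).
have [r2 hr2] := common_den_sum (R := fun f => P f && (f j < f i)%N) (g := fun f => t f + t (sf f))
  (fun f h => offdiag f (proj2 (andP h))).
by exists (r1 + r2); rewrite mulrDr hr1 hr2 tofracD.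
Qed.

(** Replacing x_i by x_j identifies only the indices i and j, and [h] omits that pair in both
    orders. *)
Lemma pair_codim_neq0 :
  (h \mPo [tuple (if k == i then 'X_j else 'X_k : A) | k < n]) != 0.
Proof.
rewrite rmorph_prod /=; apply/prodf_neq0 => -[a b] /and3P[/= ab].
rewrite !xpair_eqE !negb_and => abij abji.
rewrite rmorphB /= !comp_mpolyXU -!tnth_nth !tnth_mktuple -tofrac_eq0 tofracB.
have varE k : (if k == i then 'X_j else 'X_k : A) = 'X_(if k == i then j else k).
  by case: ifP.
rewrite !varE tofrac_varB_neq0 //.
move: ab abij abji; have [->|ai] := eqVneq a i; have [->|bi] := eqVneq b i;
  rewrite ?eqxx //= ?orbF => h1 h2 h3;
  by first [exact: h1 | exact: h2 | exact: h3 | rewrite eq_sym; exact: h2].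
Qed.
End OnePair.

(** The sum has the common denominator of all its terms and is regular along every hyperplane x_i =
    x_j, so [pole_removal] applies. *)
Lemma hl_sum_polynomial (P : pred {ffun 'I_n -> 'I_B.+1}) :
  (forall (s : 'S_n) f, P [ffun k => f (s k)] = P f) ->
  exists p : A, \sum_(f | P f) hl_summand Q x setT (fun i => f i) = tofrac p.
Proof.
move=> Ps; apply: (@pole_removal F n _ [seq e <- index_enum _ | e.1 != e.2]) => [|e].
  rewrite big_filter; apply: common_den_sum => f _; exists (pair_num q id (fun i => f i)).
  exact: (pair_den_summand q (@inj_id _)).
rewrite mem_filter => /andP[ne _]; split=> //.
have [r hr] := pair_regular ne (fun f => Ps (tperm e.1 e.2) f).
by eexists; exists r; split; [exact: hr | exact: pair_codim_neq0].
Qed.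

End PairSwap.

(** * Exponent vectors and their underlying partitions *)

Section Shape.
Variables (n B : nat).

Definition shape_seq (f : 'I_n -> nat) : seq nat :=
  sort geq [seq v <- codom f | (0 < v)%N].

Lemma shape_proof f : is_intpart (shape_seq f).
Proof.
apply/andP; split; first by apply: sort_sorted => a b; apply: leq_total.
by rewrite mem_sort mem_filter ltnn.
Qed.

Definition shape f : intpart := IntPart (shape_proof f).

Lemma intpart_sorted (la : intpart) : sorted geq la.
Proof. by case: la => s /= /andP[]. Qed.

Lemma intpart_pos (la : intpart) : 0%N \notin (la : seq nat).
Proof. by case: la => s /= /andP[]. Qed.

Lemma geq_total : total geq.
Proof. by move=> a b /=; apply: leq_total. Qed.

Lemma geq_trans : transitive geq.
Proof. by move=> b a c /= ab bc; apply: leq_trans bc ab. Qed.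

Lemma geq_anti : antisymmetric geq.
Proof. by move=> a b /=; rewrite andbC => /anti_leq. Qed.

Lemma part_leq (la : intpart) i j : (i <= j)%N -> (part la j <= part la i)%N.
Proof.
move=> ij; rewrite /part; have [jl|jl] := ltnP j (size la); last by rewrite (nth_default _ jl).
by apply: (sorted_leq_nth geq_trans leqnn 0%N (intpart_sorted la)); rewrite ?inE ?jl ?(leq_ltn_trans ij jl).
Qed.

Lemma perm_codom (f : 'I_n -> nat) (s : 'S_n) :
  perm_eq (codom (fun k => f (s k))) (codom f).
Proof.
rewrite -[codom _]/(map _ (enum 'I_n)) (map_comp f s) perm_map //.
apply: uniq_perm => [||k].
- by rewrite (map_inj_uniq perm_inj) fintype.enum_uniq.
- exact: fintype.enum_uniq.
rewrite mem_enum inE; apply/mapP; exists (s^-1%g k); rewrite ?mem_enum //.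
by rewrite permKV.
Qed.

Lemma shape_comp (f : 'I_n -> nat) (s : 'S_n) : shape (fun k => f (s k)) = shape f.
Proof.
apply: val_inj; rewrite /= /shape_seq.
apply/(perm_sortP geq_total geq_trans geq_anti); apply: perm_filter.
exact: perm_codom.
Qed.

Lemma shape_perm (la : intpart) (s : 'S_n) : (size la <= n)%N ->
  shape (fun k => part la (s k)) = la.
Proof.
move=> ln; apply: val_inj => /=; rewrite /shape_seq.
rewrite -[RHS](sorted_sort geq_trans (intpart_sorted la)).
apply/(perm_sortP geq_total geq_trans geq_anti).
have p1 : perm_eq (codom (fun k : 'I_n => part la (s k))) (mkseq (part la) n).
  apply: perm_trans (perm_codom (fun k : 'I_n => part la k) s) _.
  by rewrite /mkseq -val_enum_ord -map_comp.
apply: perm_trans (perm_filter _ p1) _.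
have -> : mkseq (part la) n = la ++ nseq (n - size la) 0%N.
  apply: (@eq_from_nth _ 0%N); first by rewrite size_mkseq size_cat size_nseq subnKC.
  move=> i; rewrite size_mkseq => lin; rewrite nth_mkseq // nth_cat nth_nseq.
  by case: ltnP => // h; rewrite /part nth_default // if_same.
rewrite filter_cat [X in _ ++ X](_ : _ = [::]) ?cats0.
  by rewrite (all_filterP _) //; apply/allP => v vl; rewrite lt0n; apply: contraNneq (intpart_pos la) => <-.
by elim: (n - size la)%N.
Qed.

(** The values of f are, up to order, the parts of [la] padded with zeros to n entries. *)
Lemma shape_permP (la : intpart) (f : 'I_n -> nat) : shape f = la ->
  exists s : 'S_n, forall k, f k = part la (s k).
Proof.
move=> <-; set mu := shape f.
have zero : [seq v <- codom f | ~~ (0 < v)%N] = nseq (n - size mu) 0%N.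
  have -> : (n - size mu)%N = size [seq v <- codom f | ~~ (0 < v)%N].
    rewrite /= /shape_seq size_sort !size_filter -{1}(card_ord n) -(size_codom f).
    by rewrite -(count_predC (fun v => 0 < v)%N (codom f)) addKn.
  apply/all_pred1P/allP => v; rewrite mem_filter -eqn0Ngt => /andP[/eqP->] _.
  by rewrite /= eqxx.
have mun : (size mu <= n)%N.
  rewrite /= /shape_seq size_sort size_filter -[X in (_ <= X)%N](card_ord n) -(size_codom f).
  exact: count_size.
have pf : perm_eq (codom f) [tuple part mu k | k < n].
  have /permPl pc := perm_filterC (fun v => 0 < v)%N (codom f).
  rewrite perm_sym in pc; apply: perm_trans pc _; rewrite zero.
  have -> : val [tuple part mu k | k < n] = mu ++ nseq (n - size mu) 0%N.
    apply: (@eq_from_nth _ 0%N); first by rewrite size_tuple size_cat size_nseq subnKC.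
    move=> i; rewrite size_tuple => lin; rewrite (nth_map (Ordinal lin)) ?size_enum_ord //.
    rewrite nth_enum_ord // nth_cat nth_nseq.
    by case: ltnP => // h; rewrite /part nth_default // if_same.
  by rewrite perm_cat2r perm_sym perm_sort.
have /tuple_permP[s hs] := pf.
exists s => k.
have := congr1 (fun u => nth 0%N u k) hs.
rewrite -[codom f]/(map f _) (nth_map k) -?enumT ?size_enum_ord // nth_ord_enum => ->.
rewrite (nth_map k) -?enumT ?size_enum_ord // nth_ord_enum.
by rewrite tnth_mktuple.
Qed.

End Shape.

(** * Hall-Littlewood polynomials as sums over rearrangements *)

Section HLPoly.
Variables (F : fieldType) (q : F) (n : nat).
Local Notation A := {mpoly F[n]}.
Local Notation E := {fraction A}.
Local Notation Q := (tofrac q%:MP_[n] : E).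
Local Notation x := (fun i : 'I_n => tofrac ('X_i : A)).

Lemma size_shape (f : 'I_n -> nat) : (size (shape f) <= n)%N.
Proof.
rewrite /= /shape_seq size_sort size_filter -[X in (_ <= X)%N](card_ord n) -(size_codom f).
exact: count_size.
Qed.

Section OnePartition.
Variables (B : nat) (la : intpart).
Hypotheses (ln : (size la <= n)%N) (lB : (part la 0 <= B)%N).

(** The term of w puts the exponent [part la i] on the variable x_(w i), hence the inverse. *)
Let fw (w : 'S_n) : {ffun 'I_n -> 'I_B.+1} := [ffun k => inord (part la (w^-1%g k))].

Let fwE w k : fw w k = part la (w^-1%g k) :> nat.
Proof. by rewrite ffunE inordK // ltnS (leq_trans _ lB) // part_leq. Qed.

Let hl_term_fw w : hl_term q la w = hl_summand Q x setT (fun i => fw w i).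
Proof.
rewrite /hl_term /hl_summand; congr (_ * _).
  rewrite [RHS](reindex_inj (@perm_inj _ w)) /=.
  by apply: eq_big => [i|i _]; rewrite ?inE // fwE permK.
rewrite [RHS](reindex_inj (@perm_inj _ w)) /=.
apply: eq_big => [i|i _]; first by rewrite inE.
rewrite [RHS](reindex_inj (@perm_inj _ w)) /= big_mkcond.
by apply: eq_big => [j|j _]; rewrite ?inE // !fwE !permK.
Qed.

Let rcosetE w : (part_stab n la :* w)%g = [set v | fw v == fw w]%SET.
Proof.
apply/setP => v; rewrite mem_rcoset !inE; apply/forallP/eqP => [h|h k].
  apply/ffunP => k; apply: val_inj; rewrite /= !fwE.
  by have /eqP := h (v^-1%g k); rewrite permM permKV.
by rewrite permM -fwE -h fwE permK.
Qed.

Let repr_rcoset w : fw (repr (part_stab n la :* w)%g) = fw w.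
Proof.
have : repr (part_stab n la :* w)%g \in (part_stab n la :* w)%g.
  by apply: (@mem_repr _ _ w); rewrite rcosetE inE.
by rewrite {2}rcosetE inE => /eqP.
Qed.

(** The cosets of the stabilizer are the fibres of [fw], so sending a coset to its rearrangement is
    a bijection onto the functions of shape [la]. *)
Lemma hl_frac_sum : hl_frac q n la =
  \sum_(f : {ffun 'I_n -> 'I_B.+1} | shape (fun i => f i) == la)
    hl_summand Q x setT (fun i => f i).
Proof.
rewrite /hl_frac ln.
transitivity (\sum_(f in (fun C => fw (repr C)) @: rcosets (part_stab n la) [set: 'S_n]%SET)
    hl_summand Q x setT (fun i => f i)).
  rewrite [RHS]big_imset /=; first by apply: eq_bigr => C _; apply: hl_term_fw.
  move=> C C' /rcosetsP[w _ ->] /rcosetsP[w' _ ->]; rewrite !repr_rcoset => e.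
  by rewrite !rcosetE e.
apply: eq_bigl => f; apply/imsetP/eqP => [[C /rcosetsP[w _ ->]]|].
  rewrite repr_rcoset => ->; rewrite -[RHS](shape_perm w^-1%g ln).
  by congr shape; apply: funext => k; rewrite fwE.
move=> /shape_permP[s hs]; exists (part_stab n la :* s^-1)%g.
  by apply/rcosetsP; exists s^-1%g; rewrite ?inE.
by rewrite repr_rcoset; apply/ffunP => k; apply: val_inj; rewrite /= fwE hs invgK.
Qed.

End OnePartition.

(** Any bound B on the largest part is allowed, so one B serves all partitions of a box. When [la]
    has more than n parts, both sides are zero. *)
Lemma hl_polyE B (la : intpart) : (part la 0 <= B)%N ->
  tofrac (hl_poly q n la) =
  \sum_(f : {ffun 'I_n -> 'I_B.+1} | shape (fun i => f i) == la)
    hl_summand Q x setT (fun i => f i).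
Proof.
move=> lB.
have fracE : hl_frac q n la = \sum_(f : {ffun 'I_n -> 'I_B.+1} | shape (fun i => f i) == la)
    hl_summand Q x setT (fun i => f i).
  have [ln|nl] := leqP (size la) n; first exact: hl_frac_sum.
  rewrite /hl_frac leqNgt nl /= big1 // => f /eqP fla.
  by have := size_shape (fun i => f i); rewrite fla leqNgt nl.
have [s f|p hp] := @hl_sum_polynomial F n q B (fun f => shape (fun i => f i) == la).
  congr (_ == la); rewrite -(shape_comp (fun i => f i) s); congr shape.
  by apply: funext => k; rewrite ffunE.
rewrite -fracE /hl_poly.
(* A polynomial representing [hl_frac] exists, so the choice in [hl_poly] does not fall back on its
   default. *)
have := @xgetPex _ 0 [set p | tofrac p = hl_frac q n la]%classic; apply.
by exists p; rewrite /= fracE hp.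
Qed.

(** Some variable carries the largest part as exponent. This bound on the order leaves, among
    partitions of bounded length, only finitely many that reach a given coefficient. *)
Lemma mord_hl_poly (la : intpart) : mord (part la 0) (hl_poly q n la).
Proof.
apply/ford_tofrac; rewrite (hl_polyE (leqnn _)); apply: ford_sum => f /eqP sf.
apply: (@fordW _ _ (\sum_(i in [set: 'I_n]%SET) f i)); last exact: ford_summand.
have [z|la0] := posnP (part la 0).
  by apply: leq_trans (leq0n _); rewrite z.
have n0 : (0 < n)%N.
  apply: leq_trans (size_shape (fun i => f i)); rewrite sf lt0n.
  by apply: contraTneq la0 => /size0nil e; rewrite /part e nth_nil.
have [s hs] := shape_permP sf; have := hs (s^-1%g (Ordinal n0)).
rewrite permKV /= => e; rewrite (bigD1 (s^-1%g (Ordinal n0))) ?inE //=.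
by rewrite e leq_addr.
Qed.

Lemma hl_poly_long (la : intpart) : (n < size la)%N -> hl_poly q n la = 0.
Proof.
move=> nl; apply/eqP; rewrite -tofrac_eq0 (hl_polyE (leqnn _)) big1 // => f /eqP sf.
by have := size_shape (fun i => f i); rewrite sf leqNgt nl.
Qed.

End HLPoly.

(** * Two alphabets *)

Section LevelStatistics.

Lemma count_conj_part (la : intpart) k :
  part (conj_part la) k = count (fun p => k < p)%N la.
Proof.
rewrite /part /conj_part /= /conj_parts.
have [kl|lk] := ltnP k (part la 0); first by rewrite nth_mkseq.
rewrite nth_default ?size_mkseq //; apply/esym/eqP; rewrite -leqn0 leqNgt -has_count.
apply/hasPn => p /(nthP 0%N)[i _ <-]; rewrite -leqNgt (leq_trans _ lk) //.
exact: part_leq.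
Qed.

Lemma card_level_set n (f : 'I_n -> nat) k :
  #|level_set setT f k| = part (conj_part (shape f)) k.
Proof.
rewrite count_conj_part /= /shape_seq count_sort count_filter.
rewrite [RHS](@eq_count _ _ (fun v => k < v)%N); last by move=> v /=; lia.
rewrite count_map cardE size_filter -enumT.
by apply: eq_count => i /=; rewrite !inE.
Qed.

(** In a decreasing list the entries above k are the first c, and 0 + ... + (c - 1) = binom(c,
    2). *)
Lemma sum_index_gt (s : seq nat) k : sorted geq s ->
  (\sum_(i < size s) (if k < nth 0 s i then i : nat else 0))%N =
  'C(count (fun p => k < p)%N s, 2).
Proof.
elim/last_ind: s => [|s v IH] ss; first by rewrite big_ord0.
have ss' : sorted geq s by move: ss; rewrite -cats1 => /cat_sorted2[].
rewrite size_rcons big_ord_recr /= nth_rcons ltnn eqxx -cats1 count_cat /= addn0.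
rewrite (eq_bigr (fun i : 'I_(size s) => if (k < nth 0 s i)%N then i : nat else 0%N)); last first.
  by move=> i _; rewrite nth_cat ltn_ord.
rewrite IH //; case: ltnP => kv; last by rewrite !addn0.
have -> : count (fun p => k < p)%N s = size s.
  apply/eqP; rewrite -all_count; apply/allP => p /(nthP 0%N)[i il <-].
  apply: leq_trans kv _.
  have := sorted_leq_nth geq_trans leqnn 0%N ss i (size s).
  rewrite !inE size_rcons ltnS (ltnW il) ltnSn => /(_ isT isT isT).
  by rewrite !nth_rcons il ltnn eqxx.
by rewrite addn1 binS bin1 addnC.
Qed.

(** Count i once for each k < lambda_i and exchange the sums. Levels between the largest part and B
    contribute zero. *)
Lemma nstat_conj (la : intpart) B : (part la 0 <= B)%N ->
  nstat la = (\sum_(k < B) 'C(part (conj_part la) k, 2))%N.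
Proof.
move=> lB; under eq_bigr => k _ do
  rewrite count_conj_part -(sum_index_gt _ (intpart_sorted la)).
rewrite exchange_big; apply: eq_bigr => i _.
rewrite -big_mkcond /=.
have iB : (part la i <= B)%N by apply: leq_trans lB; apply: part_leq.
by rewrite (big_ord_narrow iB) sum_nat_const card_ord mulnC.
Qed.

Lemma conj_part_size (la : intpart) k : (part la 0 <= k)%N -> part (conj_part la) k = 0%N.
Proof. by move=> lk; rewrite /part nth_default // size_mkseq. Qed.

Lemma pairing_conj (la mu : intpart) B : (part la 0 <= B)%N ->
  pairing (conj_part la) (conj_part mu) =
  (\sum_(k < B) part (conj_part la) k * part (conj_part mu) k)%N.
Proof.
move=> lB; rewrite /pairing /= size_mkseq [RHS](bigID (fun k : 'I_B => k < part la 0)%N) /=.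
rewrite [X in (_ + X)%N]big1 ?addn0 ?(big_ord_narrow lB) // => k.
by rewrite -leqNgt => /conj_part_size->.
Qed.
End LevelStatistics.

Section TwoAlphabets.
Variables (F : fieldType) (q : F) (n m : nat).
Local Notation A := (mpoly (n + m) F).
Local Notation E := {fraction A}.
Local Notation Q := (tofrac q%:MP_[n + m] : E).

Definition embed_vars k (v : 'I_k -> 'I_(n + m)) (p : mpoly k F) : A :=
  p \mPo [tuple 'X_(v i) | i < k].

(** Renaming the variables of a rational identity goes through polynomials: clear the common
    denominator, substitute in [key], and divide by the renamed denominator, which is nonzero as [v]
    is injective. *)
Lemma embed_hl_poly k (v : 'I_k -> 'I_(n + m)) B (la : intpart) : injective v ->
  (part la 0 <= B)%N ->
  tofrac (embed_vars v (hl_poly q k la)) =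
  \sum_(f : {ffun 'I_k -> 'I_B.+1} | shape (fun i => f i) == la)
    hl_summand Q (fun i => tofrac 'X_(v i)) setT (fun i => f i).
Proof.
move=> v_inj lB.
have D0 : tofrac (pair_den F v) != 0 by rewrite tofrac_eq0 pair_den_neq0.
apply: (mulfI D0); rewrite mulr_sumr.
under [RHS]eq_bigr => f _ do rewrite pair_den_summand //.
have X_v (i : 'I_k) : 'X_i \mPo [tuple ('X_(v i) : A) | i < k] = 'X_(v i).
  by rewrite comp_mpolyXU -tnth_nth tnth_mktuple.
have denE : embed_vars v (pair_den F id) = pair_den F v.
  rewrite /embed_vars /pair_den rmorph_prod /=; apply: eq_bigr => e _.
  by rewrite rmorphB /= !X_v.
have numE f : embed_vars v (pair_num q id f) = pair_num q v f.
  rewrite /embed_vars /pair_num rmorphM !rmorph_prod /=; congr (_ * _).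
    by apply: eq_bigr => i _; rewrite rmorphXn /= X_v.
  by apply: eq_bigr => e _; case: ifP => _; rewrite rmorphB ?rmorphM /= ?comp_mpolyC !X_v.
have key : pair_den F id * hl_poly q k la =
    \sum_(f : {ffun 'I_k -> 'I_B.+1} | shape (fun i => f i) == la)
      pair_num q id (fun i => f i).
  apply/eqP; rewrite -tofrac_eq tofracM (hl_polyE q k lB) mulr_sumr rmorph_sum /=.
  by apply/eqP; apply: eq_bigr => f _; rewrite -(pair_den_summand q (@inj_id _)).
rewrite -denE -tofracM -rmorph_sum /=; congr tofrac.
rewrite /embed_vars -rmorphM /= key rmorph_sum /=; apply: eq_bigr => f _.
exact: numE.
Qed.

Definition box_shapes k B : seq intpart :=
  undup [seq shape (fun i => f i) | f : {ffun 'I_k -> 'I_B.+1}].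

Lemma box_shapesP k B (la : intpart) :
  reflect ((size la <= k)%N /\ (part la 0 <= B)%N) (la \in box_shapes k B).
Proof.
rewrite mem_undup; apply: (iffP mapP) => [[f _ ->]|[lk lB]].
  split; first exact: size_shape.
  rewrite /part; case e : (parts (shape _)) => [|v s] //=.
  have : v \in parts (shape (fun i => f i)) by rewrite e mem_head.
  rewrite mem_sort mem_filter => /andP[_ /codomP[i ->]].
  by rewrite -ltnS.
exists [ffun i => inord (part la (i : 'I_k))]; first by rewrite mem_enum.
rewrite -[LHS](shape_perm 1%g lk); congr shape; apply: funext => i.
by rewrite ffunE perm1 inordK // ltnS (leq_trans _ lB) // part_leq.
Qed.

Lemma big_by_shape (R : nmodType) k B (G : {ffun 'I_k -> 'I_B.+1} -> R) :
  \sum_f G f =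
  \sum_(la <- box_shapes k B)
    \sum_(f : {ffun 'I_k -> 'I_B.+1} | shape (fun i => f i) == la) G f.
Proof.
rewrite (exchange_big_dep xpredT) //=; apply: eq_bigr => f _.
rewrite [RHS]big_mkcond (bigD1_seq (shape (fun i => f i))) ?undup_uniq //=; last first.
  by rewrite mem_undup; apply/mapP; exists f; rewrite ?mem_enum.
by rewrite eqxx big1 ?addr0 // => la; rewrite eq_sym => /negbTE->.
Qed.

Definition hl_weight (la mu : intpart) : F :=
  q ^ ((nstat la)%:Z + (nstat mu)%:Z - (pairing (conj_part la) (conj_part mu))%:Z).

Definition box_sum B : A :=
  \sum_(la <- box_shapes n B) \sum_(mu <- box_shapes m B)
    hl_weight la mu *: (embed_vars (lshift m) (hl_poly q n la) *
                        embed_vars (@rshift n m) (hl_poly q m mu)).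

Hypothesis q0 : q != 0.

Lemma tofrac_hl_weight B (f : 'I_n -> nat) (g : 'I_m -> nat) :
  (part (shape f) 0 <= B)%N -> (part (shape g) 0 <= B)%N ->
  tofrac (hl_weight (shape f) (shape g))%:MP = pair_weight Q B setT setT f g.
Proof.
move=> fB gB; rewrite /hl_weight (nstat_conj fB) (nstat_conj gB) (pairing_conj _ fB).
rewrite /pair_weight expfzDr // expfzDr // -exprnN -!exprnP.
have -> : \prod_(k < B) (Q ^+ 'C(#|level_set setT f k|, 2) *
    Q ^+ 'C(#|level_set setT g k|, 2) /
    Q ^+ (#|level_set setT f k| * #|level_set setT g k|)) =
  \prod_(k < B) Q ^+ 'C(part (conj_part (shape f)) k, 2) *
  \prod_(k < B) Q ^+ 'C(part (conj_part (shape g)) k, 2) /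
  \prod_(k < B) Q ^+ (part (conj_part (shape f)) k * part (conj_part (shape g)) k).
  by rewrite -big_split -prodf_div; apply: eq_bigr => k _; rewrite !card_level_set.
rewrite !prodrXr.
have Q0 : Q != 0 by rewrite tofrac_eq0 mpolyC_eq0.
(* Multiplying by q^<lambda', mu'> leaves only powers with natural exponents. *)
apply: (mulIf (expf_neq0 (\sum_(k < B) part (conj_part (shape f)) k *
   part (conj_part (shape g)) k)%N Q0)).
have QX k : Q ^+ k = tofrac (q ^+ k)%:MP by rewrite !rmorphXn.
by rewrite divfK ?expf_neq0 // !QX -!tofracM -!mpolyCM divfK ?expf_neq0.
Qed.

Lemma box_sum_pair_sum B :
  tofrac (box_sum B) =
  pair_sum Q (fun i : 'I_n => tofrac 'X_(lshift m i))
             (fun j : 'I_m => tofrac 'X_(rshift n j)) B setT setT.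
Proof.
rewrite /pair_sum /box_sum rmorph_sum /=.
rewrite [RHS](eq_bigl xpredT) => [|f]; last by rewrite finset.subsetT.
rewrite big_by_shape !big_seq; apply: eq_bigr => la /box_shapesP[_ lB].
under [RHS]eq_bigr => f _.
  rewrite (eq_bigl xpredT) => [|g]; last by rewrite finset.subsetT.
  rewrite big_by_shape; over.
rewrite rmorph_sum [RHS]exchange_big /= !big_seq; apply: eq_bigr => mu /box_shapesP[_ mB].
rewrite -mul_mpolyC !tofracM.
rewrite (embed_hl_poly (@lshift_inj n m) lB) (embed_hl_poly (@rshift_inj n m) mB).
rewrite mulr_suml mulr_sumr; apply: eq_bigr => f /eqP sf.
rewrite !mulr_sumr; apply: eq_bigr => g /eqP sg.
by rewrite -sf -sg -tofrac_hl_weight ?sf ?sg // mulrA.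
Qed.

Definition box_num : A :=
  \prod_(i < n) \prod_(j < m) (1 - 'X_(lshift m i) * 'X_(rshift n j)).

Definition box_den : A :=
  \prod_(i < n) (1 - 'X_(lshift m i)) * \prod_(j < m) (1 - 'X_(rshift n j)) *
  \prod_(i < n) \prod_(j < m) (1 - q^-1%:MP * ('X_(lshift m i) * 'X_(rshift n j))).

(** The truncated identity, now between polynomials in the joint variables; [ford_tofrac] turns the
    order of the rational defect into a bound on its monomials. *)
Lemma mord_box_defect B : mord B (box_num - box_den * box_sum B).
Proof.
have := ford_defect (@lshift_inj n m) (@rshift_inj n m) q0 B setT setT.
rewrite -box_sum_pair_sum => /= defect; apply/ford_tofrac; move: defect.
congr ford.
have QV : Q^-1 = tofrac q^-1%:MP_[n + m].
  have Q0 : Q != 0 by rewrite tofrac_eq0 mpolyC_eq0.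
  by apply: (mulfI Q0); rewrite divff // -tofracM -mpolyCM divff // mpolyC1 tofrac1.
rewrite tofracB tofracM; congr (_ - _ * _).
  rewrite /prod_num /box_num rmorph_prod /=.
  apply: eq_big => [i|i _]; rewrite ?inE // rmorph_prod /=.
  by apply: eq_big => [j|j _]; rewrite ?inE // tofracB tofrac1 tofracM.
rewrite /prod_den /box_den !tofracM !rmorph_prod /=; congr (_ * _ * _).
- by apply: eq_big => [j|j _]; rewrite ?inE // tofracB tofrac1.
- by apply: eq_big => [j|j _]; rewrite ?inE // tofracB tofrac1.
apply: eq_big => [i|i _]; rewrite ?inE // rmorph_prod /=.
by apply: eq_big => [j|j _]; rewrite ?inE // tofracB tofrac1 !tofracM QV.
Qed.

End TwoAlphabets.

(** * Formal power series *)

Section FpsTheory.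
Variables (I : choiceType) (K : fieldType).
Local Notation R := (fps I K).
Implicit Types (f g h : R) (m a b : {cmonom I}) (S : {cmonom I} -> Prop).

Lemma fps_coef_sum (T : Type) (r : seq T) (P : pred T) (G : T -> R) m :
  coef (\sum_(t <- r | P t) G t) m = \sum_(t <- r | P t) coef (G t) m.
Proof. by elim/big_rec2: _ => // t a b _ <-. Qed.

(** Congruence modulo the series supported off [S], which form an ideal when [S] is closed under
    divisors. The sets in use are the divisors of a monomial and the monomials of bounded degree. *)
Definition fps_eqon S f g : Prop := forall m, S m -> coef f m = coef g m.

Definition divisor_closed S : Prop := forall a b, S (mmul a b) -> S a.

Lemma fps_eqonM S f f' g g' : divisor_closed S ->
  fps_eqon S f f' -> fps_eqon S g g' -> fps_eqon S (f * g) (f' * g').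
Proof.
move=> cS ff gg m Sm; have [D hD] := cmonom_divisors m.
rewrite -[LHS]/(coef (fps_mul f g) m) -[RHS]/(coef (fps_mul f' g') m) !(fps_mulE hD).
apply: eq_bigr => a _; apply: eq_bigr => b /eqP ab.
have Sa : S a by apply: (cS a b); rewrite ab.
have Sb : S b by apply: (cS b a); rewrite mulmC ab.
by rewrite ff // gg.
Qed.

Lemma fps_eqon_refl S f : fps_eqon S f f. Proof. by []. Qed.

Lemma fps_eqon_sym S f g : fps_eqon S f g -> fps_eqon S g f.
Proof. by move=> fg m /fg. Qed.

Lemma fps_eqon_trans S f g h : fps_eqon S f g -> fps_eqon S g h -> fps_eqon S f h.
Proof. by move=> fg gh m Sm; rewrite fg // gh. Qed.

Lemma fps_eqonB S f f' g g' :
  fps_eqon S f f' -> fps_eqon S g g' -> fps_eqon S (f - g) (f' - g').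
Proof. by move=> ff gg m Sm; rewrite /= ff // gg. Qed.

Lemma fps_eqon_prod S (T : Type) (r : seq T) (P : pred T) (G H : T -> R) :
  divisor_closed S -> (forall t, P t -> fps_eqon S (G t) (H t)) ->
  fps_eqon S (\prod_(t <- r | P t) G t) (\prod_(t <- r | P t) H t).
Proof.
move=> cS GH; elim/big_rec2: _ => [|t f g Pt fg]; first exact: fps_eqon_refl.
by apply: fps_eqonM => //; apply: GH.
Qed.

Lemma fps_eqon_inv1 S f : divisor_closed S -> f \is a GRing.unit ->
  fps_eqon S f 1 -> fps_eqon S f^-1 1.
Proof.
move=> cS uf f1; rewrite -(mulVr uf) -[X in fps_eqon S X _]mulr1.
by apply: fps_eqonM => //; apply: fps_eqon_sym.
Qed.

Definition divides m a : Prop := exists b, mmul a b = m.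

Lemma divides_closed m : divisor_closed (divides m).
Proof. by move=> a b [c <-]; exists (mmul b c); rewrite mulmA. Qed.

Definition lowdeg k a : Prop := (monalg.mdeg a < k)%N.

Lemma lowdeg_closed k : divisor_closed (lowdeg k).
Proof. by move=> a b; apply: leq_ltn_trans; rewrite monalg.mdegM leq_addr. Qed.

Definition fps_ord k f : Prop := fps_eqon (lowdeg k) f 0.

Lemma fps_ordM k l f g : fps_ord k f -> fps_ord l g -> fps_ord (k + l) (f * g).
Proof.
move=> fk gl m mkl; have [D hD] := cmonom_divisors m.
rewrite -[LHS]/(coef (fps_mul f g) m) (fps_mulE hD) big1 // => a _; rewrite big1 // => b /eqP ab.
have [ak|ka] := ltnP (monalg.mdeg a) k; first by rewrite fk // mul0r.
rewrite (gl b) ?mulr0 //; move: mkl; rewrite /lowdeg -ab monalg.mdegM; lia.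
Qed.

Lemma fps_ord0 f : fps_ord 0 f. Proof. by []. Qed.

Lemma fps_ordX k f : fps_ord 1 f -> fps_ord k (f ^+ k).
Proof.
move=> f1; elim: k => [|k IH]; first exact: fps_ord0.
by rewrite exprS; apply: (@fps_ordM 1).
Qed.

Lemma fps_ordMl k f g : fps_ord k g -> fps_ord k (f * g).
Proof. by move=> gk; apply: (@fps_ordM 0). Qed.

Lemma unit_subr1 f : fps_ord 1 f -> 1 - f \is a GRing.unit.
Proof.
move=> f1.
pose geo k := \sum_(i < k) f ^+ i.
(* Since f^i has order at least i, the coefficient of the geometric series at m is settled by its
   first deg m + 1 terms. *)
pose g : R := Fps (fun m => coef (geo (monalg.mdeg m).+1) m).
have gE k : fps_eqon (lowdeg k) g (geo k).
  move=> m mk; rewrite /= /geo !fps_coef_sum [RHS](bigID (fun i : 'I_k => i < (monalg.mdeg m).+1)%N) /=.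
  rewrite (big_ord_narrow mk) [X in _ + X]big1 ?addr0 // => i.
  by rewrite -leqNgt => im; rewrite (fps_ordX f1) // /lowdeg.
have gK : g * (1 - f) = 1.
  apply: fpsP => m; have lm : lowdeg (monalg.mdeg m).+1 m by rewrite /lowdeg.
  rewrite (fps_eqonM (@lowdeg_closed _) (gE (monalg.mdeg m).+1) (fps_eqon_refl _) lm).
  have -> : geo (monalg.mdeg m).+1 * (1 - f) = 1 - f ^+ (monalg.mdeg m).+1.
    by rewrite -[RHS]opprB subrX1 -mulNr opprB mulrC.
  by rewrite /= -[coef (f ^+ _) m]/(coef _ m) (fps_ordX f1 lm) subr0.
by apply/unitrP; exists g; rewrite [_ * g]mulrC.
Qed.

Section InfProd.
Variables (T : choiceType) (u : T -> R).

Lemma prod_eqon S (A0 A : {fset T}) : divisor_closed S -> (A0 `<=` A)%fset ->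
  (forall t, t \notin A0 -> fps_eqon S (u t) 1) ->
  fps_eqon S (\prod_(t <- A) u t) (\prod_(t <- A0) u t).
Proof.
move=> cS sA uA0; rewrite (bigID (fun t => t \in A0)) /= -[X in fps_eqon S _ X]mulr1.
apply: fps_eqonM => //.
  rewrite -big_filter (perm_big A0) //=; apply: uniq_perm; rewrite ?filter_uniq //.
  by move=> t; rewrite mem_filter; case: (boolP (t \in A0)) => //= /(fsubsetP sA) ->.
have := fps_eqon_prod A cS uA0.
by rewrite big1_eq.
Qed.

Hypothesis hu : forall m, exists A0 : {fset T},
  forall t, t \notin A0 -> fps_eqon (divides m) (u t) 1.

Lemma infprod_spec : has_prod u (infprod u).
Proof.
apply: (@xgetPex _ 1 [set s | has_prod u s]%classic).
(* The factors outside [A m] are 1 on the divisors of m, so the product over [A m] already has the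
   limiting coefficient at m. *)
have [A hA] := choice hu.
exists (Fps (fun m => coef (\prod_(t <- A m) u t) m)) => m.
exists (A m) => A' AA' /=; apply: (prod_eqon (@divides_closed m) AA' (hA m)).
by exists mone; rewrite mulm1.
Qed.

(** Strengthens convergence at single monomials: one finite product matches the infinite one at all
    divisors of m, so the comparison can be multiplied with others. *)
Lemma infprod_eqon m (A : {fset T}) :
  (forall t, t \notin A -> fps_eqon (divides m) (u t) 1) ->
  fps_eqon (divides m) (infprod u) (\prod_(t <- A) u t).
Proof.
move=> uA a am; have [A0 hA0] := infprod_spec a.
rewrite -(hA0 (A0 `|` A)%fset) ?fsubsetUl //.
exact: (prod_eqon (@divides_closed m) (fsubsetUr _ _) uA).
Qed.

Lemma multipliable_infprod : multipliable u.
Proof. by exists (infprod u); apply: infprod_spec. Qed.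

End InfProd.

Definition fps_mono a : R := Fps (fun m => (m == a)%:R).

Lemma fps_monoM a b : fps_mono (mmul a b) = fps_mono a * fps_mono b.
Proof.
apply: fpsP => m; have [D hD] := cmonom_divisors m.
rewrite -[RHS]/(coef (fps_mul _ _) m) (fps_mulE hD) /=.
transitivity (\sum_(c <- D) \sum_(d <- D) (if (c == a) && (d == b) then (mmul c d == m)%:R else 0 : K)); last first.
  apply: eq_bigr => c _; rewrite [RHS]big_mkcond; apply: eq_bigr => d _.
  by case: (c == a); case: (d == b); case: (mmul c d == m); rewrite ?mulr1 ?mulr0.
have [me|ne] := eqVneq m (mmul a b).
  have [aD bD] := hD _ _ (esym me).
  rewrite (bigD1_seq a) ?fset_uniq //= (bigD1_seq b) ?fset_uniq //= !eqxx -me eqxx.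
  rewrite big1 ?addr0 => [|d /negbTE-> //]; rewrite big1 ?addr0 // => c /negbTE ca.
  by rewrite big1 // => d _; rewrite ca.
rewrite big1 // => c _; rewrite big1 // => d _.
by case: eqP => //= ->; case: eqP => //= ->; rewrite eq_sym (negbTE ne).
Qed.

Lemma fps_mono1 : fps_mono mone = 1. Proof. by []. Qed.

Lemma expcmnS a k : expcmn a k.+1 = mmul a (expcmn a k).
Proof. by case: k => [|k]; [rewrite /expcmn /= mulm1 | rewrite /expcmn /= ]. Qed.

Lemma fps_monoX a k : fps_mono (expcmn a k) = fps_mono a ^+ k.
Proof. by elim: k => [|k IH]; rewrite ?expr0 // exprS -IH expcmnS fps_monoM. Qed.

Lemma fps_mono_prod (T : Type) (r : seq T) (P : pred T) (G : T -> {cmonom I}) :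
  fps_mono (\big[mmul/mone]_(t <- r | P t) G t) = \prod_(t <- r | P t) fps_mono (G t).
Proof. exact: (big_morph _ fps_monoM fps_mono1). Qed.

Lemma cmonom_prodE (T : Type) (r : seq T) (P : pred T) (G : T -> {cmonom I}) i :
  (\big[mmul/mone]_(t <- r | P t) G t) i = (\sum_(t <- r | P t) G t i)%N.
Proof.
exact: (big_morph (fun m : {cmonom I} => m i) (fun a b => cmM i a b) (cm1 i)).
Qed.

Lemma expcmnE a k i : expcmn a k i = (k * a i)%N.
Proof.
by elim: k => [|k IH]; [exact: cm1 | rewrite expcmnS cmM IH mulSn].
Qed.

Lemma fps_ord_mono a : fps_ord (monalg.mdeg a) (fps_mono a).
Proof. by move=> m; rewrite /lowdeg /=; case: eqP => // ->; rewrite ltnn. Qed.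

End FpsTheory.

(** * Polynomials as power series *)

Section MpolyToFps.
Variables (I : choiceType) (F : fieldType) (n : nat) (v : 'I_n -> I).
Hypothesis v_inj : injective v.
Local Notation R := (fps I F).

Definition fps_of_mpoly : mpoly n F -> R :=
  mmap (GRing.in_alg R) (fun i => fps_var F (v i)).

HB.instance Definition _ := GRing.RMorphism.on fps_of_mpoly.

Definition cmonom_of_multinom (m : multinom n) : {cmonom I} :=
  \big[mmul/mone]_(i < n) expcmn (ucm (v i)) (m i).

Lemma cmonom_of_multinomE m i : cmonom_of_multinom m (v i) = m i.
Proof.
rewrite /cmonom_of_multinom cmonom_prodE (bigD1 i) //= expcmnE ucmE eqxx muln1.
rewrite big1 ?addn0 // => j ji; rewrite expcmnE ucmE.
by rewrite (inj_eq v_inj) (negbTE ji) muln0.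
Qed.

Lemma cmonom_of_multinom_out m k : (forall i, v i != k) -> cmonom_of_multinom m k = 0%N.
Proof.
move=> vk; rewrite /cmonom_of_multinom cmonom_prodE big1 // => i _.
by rewrite expcmnE ucmE (negbTE (vk i)) muln0.
Qed.

Lemma coef_fps_of_mpoly p a : coef (fps_of_mpoly p) a =
  \sum_(m <- msupp p) p@_m * (a == cmonom_of_multinom m)%:R.
Proof.
rewrite /fps_of_mpoly /mmap fps_coef_sum; apply: eq_bigr => m _.
have -> : mmap1 (fun i => fps_var F (v i)) m = fps_mono F (cmonom_of_multinom m).
  by rewrite fps_mono_prod; apply: eq_bigr => i _; rewrite fps_monoX.
by rewrite in_algE mulr_algl.
Qed.

Lemma coef_fps_of_mpoly_in p m : coef (fps_of_mpoly p) (cmonom_of_multinom m) = p@_m.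
Proof.
have m_inj m' : (cmonom_of_multinom m == cmonom_of_multinom m') = (m == m').
  apply/eqP/eqP => [e|->//]; apply/mnmP => i.
  by rewrite -!cmonom_of_multinomE e.
rewrite coef_fps_of_mpoly; have [mp|mp] := boolP (m \in msupp p).
  rewrite (bigD1_seq m) ?msupp_uniq //= eqxx mulr1 big1 ?addr0 // => m' /negbTE ne.
  by rewrite m_inj eq_sym ne mulr0.
rewrite (memN_msupp_eq0 mp) big1_seq // => m' /andP[_ mp'].
by rewrite m_inj; case: eqP mp' mp => [-> ->|_ _ _]; rewrite ?mulr0.
Qed.

Lemma coef_fps_of_mpoly_out p (a : {cmonom I}) k : (forall i, v i != k) -> a k != 0%N ->
  coef (fps_of_mpoly p) a = 0.
Proof.
move=> vk ak; rewrite coef_fps_of_mpoly big1 // => m _.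
case: eqP => [e|_]; last by rewrite mulr0.
by move: ak; rewrite e cmonom_of_multinom_out.
Qed.

Lemma fps_of_mpolyX i : fps_of_mpoly 'X_i = fps_var F (v i).
Proof. by rewrite /fps_of_mpoly mmapX mmap1U. Qed.

Lemma fps_of_mpolyC c : fps_of_mpoly c%:MP = c%:A.
Proof. by rewrite /fps_of_mpoly mmapC. Qed.

Lemma mdeg_cmonom_of_multinom m : monalg.mdeg (cmonom_of_multinom m) = mdeg m.
Proof.
rewrite /cmonom_of_multinom monalg.mdeg_prod mdegE; apply: eq_bigr => i _.
elim: (m i) => [|k IH]; first exact: monalg.mdeg1.
by rewrite expcmnS monalg.mdegM IH monalg.mdegU.
Qed.

Lemma fps_ord_mpoly k p : mord k p -> fps_ord k (fps_of_mpoly p).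
Proof.
move=> kp a ak; rewrite coef_fps_of_mpoly big1_seq // => m /andP[_ /kp km].
case: eqP => [e|_]; last by rewrite mulr0.
by move: ak; rewrite /lowdeg e mdeg_cmonom_of_multinom ltnNge km.
Qed.

End MpolyToFps.

Lemma fps_of_embed (I : choiceType) (F : fieldType) n m k (v : 'I_(n + m) -> I)
    (w : 'I_k -> 'I_(n + m)) (p : mpoly k F) :
  fps_of_mpoly v (embed_vars w p) = fps_of_mpoly (fun i => v (w i)) p.
Proof.
elim/mpolyind: p => [|c mn p _ _ IH]; first by rewrite /embed_vars !rmorph0.
rewrite /embed_vars in IH *; rewrite !rmorphD /= IH; congr (_ + _).
rewrite -!mul_mpolyC !rmorphM /= comp_mpolyC !fps_of_mpolyC; congr (_ * _).
rewrite comp_mpolyX rmorph_prod /= /fps_of_mpoly mmapX; apply: eq_bigr => i _.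
by rewrite tnth_mktuple rmorphXn; congr (_ ^+ _); apply: fps_of_mpolyX.
Qed.

(** * Coefficients of products of Hall-Littlewood functions *)

Section Rename.
Variables (I J : choiceType) (K : fieldType) (v : I -> J).
Hypothesis v_inj : injective v.

Lemma cmonom_mapE (m : {cmonom I}) i : cmonom_map v m (v i) = m i.
Proof.
rewrite /cmonom_map cmonom_prodE.
transitivity (\sum_(j <- finsupp m) (if j == i then m j else 0%N))%N.
  by apply: eq_bigr => j _; rewrite expcmnE ucmE (inj_eq v_inj); case: eqP; rewrite ?muln1 ?muln0.
rewrite -big_mkcond; have [im|im] := boolP (i \in finsupp m).
  by rewrite big_mkcond (bigD1_seq i) ?fset_uniq //= eqxx big1 ?addn0 // => j /negbTE->.
rewrite big1_seq ?(fsfun_dflt im) // => j /andP[/eqP-> ji].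
by rewrite ji in im.
Qed.

Lemma cmonom_map_out (m : {cmonom I}) k : (forall i, v i != k) -> cmonom_map v m k = 0%N.
Proof.
move=> vk; rewrite /cmonom_map cmonom_prodE big1 // => i _.
by rewrite expcmnE ucmE (negbTE (vk i)) muln0.
Qed.

Lemma coef_fps_rename (f : fps I K) m : coef (fps_rename v f) (cmonom_map v m) = coef f m.
Proof.
rewrite /fps_rename /= (_ : [set m' | _]%classic = [set m]%classic) ?fsbig_set1 //.
apply/classical_sets.seteqP; split=> m' /=; last by move=> ->.
by move=> e; apply/eqP/cmP => i; rewrite -cmonom_mapE e cmonom_mapE.
Qed.

Lemma coef_fps_rename_out (f : fps I K) (a : {cmonom J}) k :
  (forall i, v i != k) -> a k != 0%N -> coef (fps_rename v f) a = 0.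
Proof.
move=> vk ak; rewrite /fps_rename /= (_ : [set m' | _]%classic = classical_sets.set0).
  by rewrite fsbig_set0.
apply/classical_sets.seteqP; split=> m' //= e.
by move: ak; rewrite -e cmonom_map_out.
Qed.

Lemma cmonom_restrict (g : J -> option I) (M : {cmonom J}) :
  (forall i j, g j = Some i <-> j = v i) ->
  exists m : {cmonom I}, forall i, m i = M (v i).
Proof.
move=> gv; pose D := [fset i | i in pmap g (finsupp M)]%fset.
exists ([cmonom M (v i) | i in D])%M => i; rewrite cmE fsfun_fun.
case: ifPn => // iD; apply/esym/eqP; rewrite cmE_eq0; apply: contra iD => vi.
rewrite in_fset /= mem_pmap; apply/mapP; exists (v i) => //.
by apply/esym/gv.
Qed.

End Rename.

Section TwoSided.
Variable (F : fieldType).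
Local Notation R := (fps (nat + nat)%type F).
Implicit Types (f g : R) (M : {cmonom (nat + nat)%type}).

Lemma cmonom_split M : exists mx my : {cmonom nat},
  M = mmul (cmonom_map inl mx) (cmonom_map inr my).
Proof.
have [|mx hx] := @cmonom_restrict _ _ (@inl nat nat)
  (fun s => if s is inl i then Some i else None) M.
  by move=> i [j|j] /=; split=> // -[->].
have [|my hy] := @cmonom_restrict _ _ (@inr nat nat)
  (fun s => if s is inr i then Some i else None) M.
  by move=> i [j|j] /=; split=> // -[->].
exists mx, my; apply/eqP/cmP => -[i|i]; rewrite cmM.
  by rewrite [X in (_ + X)%N]cmonom_map_out // cmonom_mapE ?addn0 ?hx // => a b [].
by rewrite cmonom_map_out // cmonom_mapE ?add0n ?hy // => a b [].
Qed.

(** As f involves only left variables and g only right ones, a single factorization of the monomial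
    contributes. *)
Lemma coef_mul_separate f g (mx my : {cmonom nat}) :
  (forall (a : {cmonom (nat + nat)%type}) j, a (inr j) != 0%N -> coef f a = 0) ->
  (forall (a : {cmonom (nat + nat)%type}) i, a (inl i) != 0%N -> coef g a = 0) ->
  coef (f * g) (mmul (cmonom_map inl mx) (cmonom_map inr my)) =
  coef f (cmonom_map inl mx) * coef g (cmonom_map inr my).
Proof.
move=> hf hg; set a0 := cmonom_map inl mx; set b0 := cmonom_map inr my.
have a0r j : a0 (inr j) = 0%N by rewrite cmonom_map_out.
have b0l i : b0 (inl i) = 0%N by rewrite cmonom_map_out.
have [D hD] := cmonom_divisors (mmul a0 b0).
rewrite -[LHS]/(coef (fps_mul f g) _) (fps_mulE hD).
have [aD bD] := hD _ _ erefl.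
have zero a b : mmul a b = mmul a0 b0 -> (a != a0) || (b != b0) ->
    coef f a * coef g b = 0.
  move=> ab; rewrite -negb_and => /negP ne.
  have [[j aj]|ar] := pselect (exists j, a (inr j) != 0%N); first by rewrite (hf _ _ aj) mul0r.
  have [[i bi]|bl] := pselect (exists i, b (inl i) != 0%N); first by rewrite (hg _ _ bi) mulr0.
  have ar0 j : a (inr j) = 0%N by apply/eqP/negPn/negP => aj; apply: ar; exists j.
  have bl0 i : b (inl i) = 0%N by apply/eqP/negPn/negP => bi; apply: bl; exists i.
  case: ne; apply/andP; split; apply/cmP => -[k|k].
  - by have := congr1 (fun c : {cmonom (nat + nat)%type} => c (inl k)) ab; rewrite !cmM bl0 b0l !addn0.
  - by rewrite ar0 a0r.
  - by rewrite bl0 b0l.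
  - by have := congr1 (fun c : {cmonom (nat + nat)%type} => c (inr k)) ab; rewrite !cmM ar0 a0r.
rewrite (bigD1_seq a0) ?fset_uniq //= [X in _ + X]big1 ?addr0; last first.
  by move=> a ne; rewrite big1 // => b /eqP ab; rewrite zero // ne.
rewrite big_mkcond (bigD1_seq b0) ?fset_uniq //= eqxx big1 ?addr0 // => b ne.
by case: eqP => // ab; rewrite zero // ne orbT.
Qed.

Lemma cmonom_bound_gt (mx : {cmonom nat}) i : (cmonom_bound mx <= i)%N -> mx i = 0%N.
Proof.
move=> bi; apply/eqP; rewrite cmE_eq0; apply/negP => im.
by move: bi; rewrite /cmonom_bound (bigD1_seq i) ?fset_uniq //= geq_max ltnn.
Qed.

Lemma cmonom_map_multinom (v : nat -> (nat + nat)%type) (mx : {cmonom nat}) n :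
  injective v -> (cmonom_bound mx <= n)%N ->
  cmonom_map v mx = cmonom_of_multinom (fun i : 'I_n => v i) [multinom mx i | i < n].
Proof.
move=> v_inj bn; apply/eqP/cmP => k.
have vn_inj : injective (fun i : 'I_n => v i) by move=> i j /v_inj/val_inj.
have [[i <-]|vk] := pselect (exists i, v i = k); last first.
  by rewrite cmonom_map_out ?cmonom_of_multinom_out // => i; apply/eqP => e; apply: vk; eexists; exact: e.
rewrite cmonom_mapE //; have [ni|ni] := ltnP i n.
  by rewrite -[i]/(val (Ordinal ni)) (cmonom_of_multinomE vn_inj) mnmE.
rewrite cmonom_bound_gt ?(leq_trans bn) // cmonom_of_multinom_out // => j.
by rewrite (inj_eq v_inj); apply: contraTneq (ltn_ord j) => ->; rewrite -leqNgt.
Qed.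

Variable q : F.

(** [hl] reads its coefficient at [mx] from the polynomial in [cmonom_bound mx] variables, so these
    are the alphabet sizes to compare with. *)
Lemma coef_hl_pair (la mu : intpart) (mx my : {cmonom nat}) :
  let n := cmonom_bound mx in let m := cmonom_bound my in
  coef (fps_rename inl (hl q la) * fps_rename inr (hl q mu))
       (mmul (cmonom_map inl mx) (cmonom_map inr my)) =
  coef (fps_of_mpoly (fun i : 'I_n => inl (val i)) (hl_poly q n la) *
        fps_of_mpoly (fun j : 'I_m => inr (val j)) (hl_poly q m mu))
       (mmul (cmonom_map inl mx) (cmonom_map inr my)).
Proof.
move=> n m.
have inl_inj : injective (@inl nat nat) by move=> a b [].
have inr_inj : injective (@inr nat nat) by move=> a b [].
rewrite !coef_mul_separate; first last.
- by move=> a i; apply: coef_fps_rename_out.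
- by move=> a j; apply: coef_fps_rename_out.
- by move=> a i; apply: coef_fps_of_mpoly_out.
- by move=> a j; apply: coef_fps_of_mpoly_out.
rewrite !coef_fps_rename // (cmonom_map_multinom inl_inj (leqnn n)).
rewrite (cmonom_map_multinom inr_inj (leqnn m)) !coef_fps_of_mpoly_in //.
  by move=> i j [] /val_inj.
by move=> i j [] /val_inj.
Qed.

(** Outside the box a partition is either too long, and its polynomial is zero, or its largest part
    exceeds the degree of M, and so does the order of its polynomial. *)
Lemma coef_hl_pair_eq0 (la mu : intpart) M : 
  let B := (monalg.mdeg M).+1 in
  forall mx my, M = mmul (cmonom_map inl mx) (cmonom_map inr my) ->
  ~ (la \in box_shapes (cmonom_bound mx) B /\ mu \in box_shapes (cmonom_bound my) B) ->
  coef (fps_rename inl (hl q la) * fps_rename inr (hl q mu)) M = 0.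
Proof.
move=> B mx my eM; rewrite eM coef_hl_pair -eM.
set n := cmonom_bound mx; set m := cmonom_bound my => notin.
have small k (v : 'I_k -> (nat + nat)%type) nu : nu \notin box_shapes k B ->
    fps_ord B (fps_of_mpoly v (hl_poly q k nu)).
  move=> /box_shapesP nu_out; have [nl|nl] := leqP (size nu) k.
    apply: fps_ord_mpoly; apply: (mordW _ (@mord_hl_poly F q k nu)).
    by rewrite leqNgt; apply/negP => nB; apply: nu_out; split; rewrite // ltnW.
  by rewrite hl_poly_long // rmorph0.
have MB : lowdeg B M by rewrite /lowdeg.
have [la_in|la_out] := boolP (la \in box_shapes n B).
  have mu_out : mu \notin box_shapes m B by apply/negP => mu_in; apply: notin.
  exact: (fps_ordMl _ (small _ _ _ mu_out) MB).
by rewrite mulrC; exact: (fps_ordMl _ (small _ _ _ la_out) MB).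
Qed.

End TwoSided.

(** * The product side *)

Section Product.
Variables (F : fieldType) (q : F).
Local Notation R := (fps (nat + nat)%type F).
Implicit Types (M : {cmonom (nat + nat)%type}).

Let x (i : nat) : R := fps_var F (inl i).
Let y (j : nat) : R := fps_var F (inr j).

Let factor1 (i : nat) := 1 / ((1 - x i) * (1 - y i)).
Let factor2 (p : nat * nat) := (1 - x p.1 * y p.2) / (1 - q^-1 *: (x p.1 * y p.2)).

Lemma fps_ord_var k : fps_ord 1 (fps_var F k : R).
Proof. by move=> m; rewrite /lowdeg /=; case: eqP => // ->; rewrite monalg.mdegU. Qed.

Lemma fps_var_eqon0 M k : M k = 0%N -> fps_eqon (divides M) (fps_var F k) 0.
Proof.
move=> Mk a [b ab] /=; case: eqP => // ak.
by move: Mk; rewrite -ab ak cmM ucmE eqxx.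
Qed.

Let unit_x i : 1 - x i \is a GRing.unit.
Proof. exact/unit_subr1/fps_ord_var. Qed.

Let unit_y i : 1 - y i \is a GRing.unit.
Proof. exact/unit_subr1/fps_ord_var. Qed.

Let unit_xy i j : 1 - q^-1 *: (x i * y j) \is a GRing.unit.
Proof.
by apply: unit_subr1; rewrite scalerAl; apply: fps_ordMl; apply: fps_ord_var.
Qed.

Let factor1E i : factor1 i = (1 - x i)^-1 * (1 - y i)^-1.
Proof. rewrite /factor1 div1r (invrM (unit_x i) (unit_y i)); exact: mulrC. Qed.

Let inv_eqon1 M (f : R) : fps_ord 1 f -> fps_eqon (divides M) f 0 ->
  fps_eqon (divides M) (1 - f)^-1 1.
Proof.
move=> f1 f0; apply: fps_eqon_inv1; [exact: divides_closed|exact: unit_subr1|].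
by rewrite -[X in fps_eqon _ _ X]subr0; apply: fps_eqonB.
Qed.

Let inv_x_eqon M i : M (inl i) = 0%N -> fps_eqon (divides M) (1 - x i)^-1 1.
Proof. by move=> Mi; apply: inv_eqon1; [exact: fps_ord_var|exact: fps_var_eqon0]. Qed.

Let inv_y_eqon M i : M (inr i) = 0%N -> fps_eqon (divides M) (1 - y i)^-1 1.
Proof. by move=> Mi; apply: inv_eqon1; [exact: fps_ord_var|exact: fps_var_eqon0]. Qed.

Let factor1_eqon M i : M (inl i) = 0%N -> M (inr i) = 0%N ->
  fps_eqon (divides M) (factor1 i) 1.
Proof.
move=> xi yi; rewrite factor1E -[X in fps_eqon _ _ X]mulr1.
by apply: fps_eqonM; [exact: divides_closed|exact: inv_x_eqon|exact: inv_y_eqon].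
Qed.

Let xy_eqon M i j : M (inl i) = 0%N \/ M (inr j) = 0%N ->
  fps_eqon (divides M) (x i * y j) 0.
Proof.
case=> Mk.
  by rewrite -(mul0r (y j)); apply: fps_eqonM => //; [exact: divides_closed|exact: fps_var_eqon0].
by rewrite -(mulr0 (x i)); apply: fps_eqonM => //; [exact: divides_closed|exact: fps_var_eqon0].
Qed.

Let factor2_eqon M p : M (inl p.1) = 0%N \/ M (inr p.2) = 0%N ->
  fps_eqon (divides M) (factor2 p) 1.
Proof.
move=> Mp; rewrite /factor2 -[X in fps_eqon _ _ X]mulr1.
apply: fps_eqonM; first exact: divides_closed.
  by rewrite -[X in fps_eqon _ _ X]subr0; apply: fps_eqonB => //; apply: xy_eqon.
apply: inv_eqon1; first by rewrite scalerAl; apply: fps_ordMl; apply: fps_ord_var.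
have := xy_eqon Mp; move=> h a Ma.
by rewrite -[LHS]/(q^-1 * coef (x p.1 * y p.2) a) h //= mulr0.
Qed.

Let bounded M : exists n m, (forall i, (n <= i)%N -> M (inl i) = 0%N) /\
                            (forall j, (m <= j)%N -> M (inr j) = 0%N).
Proof.
have [mx [my eM]] := cmonom_split M.
exists (cmonom_bound mx), (cmonom_bound my); split=> i bi; rewrite eM cmM.
  by rewrite cmonom_mapE ?cmonom_bound_gt ?cmonom_map_out // => a b [].
by rewrite cmonom_map_out // cmonom_mapE ?cmonom_bound_gt // => a b [].
Qed.

Let nats n : {fset nat} := [fset i | i in iota 0 n]%fset.
Let box n m : {fset nat * nat} :=
  [fset p | p in [seq (i, j) | i <- iota 0 n, j <- iota 0 m]]%fset.

Let big_iota n (G : nat -> R) : \prod_(i <- iota 0 n) G i = \prod_(i < n) G i.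
Proof. by rewrite -(big_mkord xpredT) /index_iota subn0. Qed.

Let big_nats n (G : nat -> R) : \prod_(i <- nats n) G i = \prod_(i < n) G i.
Proof.
rewrite -big_iota; apply: perm_big.
apply: uniq_perm; rewrite ?fset_uniq ?iota_uniq // => i.
by rewrite in_fset.
Qed.

Let big_box n m (G : nat * nat -> R) :
  \prod_(p <- box n m) G p = \prod_(i < n) \prod_(j < m) G (i : nat, j : nat).
Proof.
transitivity (\prod_(i <- iota 0 n) \prod_(j <- iota 0 m) G (i, j)).
  rewrite -big_allpairs; apply: perm_big; apply: uniq_perm; rewrite ?fset_uniq //.
    by rewrite allpairs_uniq ?iota_uniq // => -[a b] [c d].
  by move=> p; rewrite in_fset.
by rewrite big_iota; apply: eq_bigr => i _; rewrite big_iota.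
Qed.

Let factor1_hu M : exists A0 : {fset nat},
  forall i, i \notin A0 -> fps_eqon (divides M) (factor1 i) 1.
Proof.
have [n [m [hn hm]]] := bounded M; exists (nats (maxn n m)) => i.
rewrite in_fset /= mem_iota /= add0n -leqNgt geq_max => /andP[ni mi].
exact: factor1_eqon (hn _ ni) (hm _ mi).
Qed.

Let notin_box n m p : p \notin box n m -> (n <= p.1)%N \/ (m <= p.2)%N.
Proof.
move=> nin; have [np|pn] := leqP n p.1; first by left.
have [mp|pm] := leqP m p.2; first by right.
case/negP: nin; rewrite in_fset; apply/allpairsP; exists p.
by split; [rewrite mem_iota | rewrite mem_iota | case: (p)].
Qed.

Let factor2_hu M : exists A0 : {fset nat * nat},
  forall p, p \notin A0 -> fps_eqon (divides M) (factor2 p) 1.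
Proof.
have [n [m [hn hm]]] := bounded M; exists (box n m) => p /notin_box [np|mp].
  by apply: factor2_eqon; left; apply: hn.
by apply: factor2_eqon; right; apply: hm.
Qed.

Lemma multipliable_factor1 : multipliable factor1.
Proof. exact: multipliable_infprod factor1_hu. Qed.

Lemma multipliable_factor2 : multipliable factor2.
Proof. exact: multipliable_infprod factor2_hu. Qed.

(** * Comparison with finitely many variables *)

Section FiniteAlphabets.
Variables (n m : nat).

Let v (k : 'I_(n + m)) : (nat + nat)%type :=
  match split k with inl i => inl (val i) | inr j => inr (val j) end.

Let v_l i : v (lshift m i) = inl (val i).
Proof. by rewrite /v (unsplitK (inl i)). Qed.

Let v_r j : v (rshift n j) = inr (val j).
Proof. by rewrite /v (unsplitK (inr j)). Qed.

Let phi : mpoly (n + m) F -> R := fps_of_mpoly v.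
HB.instance Definition _ := GRing.RMorphism.on phi.

Let phiM a b : phi (a * b) = phi a * phi b. Proof. exact: rmorphM. Qed.
Let phiB1 a : phi (1 - a) = 1 - phi a. Proof. by rewrite rmorphB rmorph1. Qed.
Let phi_prod k (G : 'I_k -> mpoly (n + m) F) :
  phi (\prod_(i < k) G i) = \prod_(i < k) phi (G i).
Proof. exact: rmorph_prod. Qed.

Let phi_l i : phi 'X_(lshift m i) = x i.
Proof. by rewrite /phi fps_of_mpolyX v_l. Qed.

Let phi_r j : phi 'X_(rshift n j) = y j.
Proof. by rewrite /phi fps_of_mpolyX v_r. Qed.

Let phi_num : phi (box_num F n m) = \prod_(i < n) \prod_(j < m) (1 - x i * y j).
Proof.
rewrite /box_num phi_prod; apply: eq_bigr => i _; rewrite phi_prod.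
by apply: eq_bigr => j _; rewrite phiB1 phiM phi_l phi_r.
Qed.

Let c (i : nat) : R := \prod_(j < m) (1 - q^-1 *: (x i * y j)).

Let phi_den : phi (box_den q n m) =
  \prod_(i < n) (1 - x i) * \prod_(j < m) (1 - y j) * \prod_(i < n) c i.
Proof.
have e1 : phi (\prod_(i < n) (1 - 'X_(lshift m i))) = \prod_(i < n) (1 - x i).
  by rewrite phi_prod; apply: eq_bigr => i _; rewrite phiB1 phi_l.
have e2 : phi (\prod_(j < m) (1 - 'X_(rshift n j))) = \prod_(j < m) (1 - y j).
  by rewrite phi_prod; apply: eq_bigr => j _; rewrite phiB1 phi_r.
have e3 : phi (\prod_(i < n) \prod_(j < m)
      (1 - q^-1%:MP * ('X_(lshift m i) * 'X_(rshift n j)))) =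
    \prod_(i < n) c i.
  rewrite phi_prod; apply: eq_bigr => i _; rewrite /c.
  rewrite phi_prod; apply: eq_bigr => j _.
  rewrite phiB1 phiM phiM phi_l phi_r.
  by rewrite /phi fps_of_mpolyC mulr_algl.
rewrite /box_den phiM phiM.
rewrite e1 e2 e3.
reflexivity.
Qed.

Let unit_prod (T : Type) (r : seq T) (G : T -> R) :
  (forall t, G t \is a GRing.unit) -> \prod_(t <- r) G t \is a GRing.unit.
Proof. by move=> uG; apply: rpred_prod. Qed.

Let inv_prod k (G : nat -> R) : (forall i, G i \is a GRing.unit) ->
  (\prod_(i < k) G i)^-1 = \prod_(i < k) (G i)^-1.
Proof. by move=> uG; rewrite prodrV. Qed.

Let unit_c i : c i \is a GRing.unit.
Proof. by rewrite /c; apply: unit_prod => j; apply: unit_xy. Qed.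

(** The divisors of M involve only the first n variables x and the first m variables y, and every
    factor with another variable is 1 on them. *)
Lemma infprod_finite M : 
  (forall i, (n <= i)%N -> M (inl i) = 0%N) ->
  (forall j, (m <= j)%N -> M (inr j) = 0%N) ->
  fps_eqon (divides M) (infprod factor1 * infprod factor2)
    (phi (box_num F n m) / phi (box_den q n m)).
Proof.
move=> hn hm; have cM := @divides_closed _ M.
have e1 : fps_eqon (divides M) (infprod factor1)
    ((\prod_(i < n) (1 - x i))^-1 * (\prod_(j < m) (1 - y j))^-1).
  (* [factor1] couples x_i with y_i, so the larger of n and m is taken first; the x and y halves are
     then cut back to n and m separately. *)
  apply: (fps_eqon_trans (infprod_eqon factor1_hu (A := nats (maxn n m)) _)).
    move=> i; rewrite in_fset /= mem_iota /= add0n -leqNgt geq_max => /andP[ni mi].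
    exact: factor1_eqon (hn _ ni) (hm _ mi).
  have sub k : (k <= maxn n m)%N -> (nats k `<=` nats (maxn n m))%fset.
    move=> km; apply/fsubsetP => i; rewrite !in_fset /= !mem_iota /= !add0n => ik.
    exact: leq_trans ik km.
  rewrite (eq_bigr _ (fun i _ => factor1E i)) big_split /=.
  apply: fps_eqonM => //.
    rewrite (inv_prod n unit_x) -(big_nats n (fun i => (1 - x i)^-1)).
    apply: (prod_eqon cM (sub _ (leq_maxl _ _))) => i.
    rewrite in_fset /= mem_iota /= add0n -leqNgt => ni; exact: inv_x_eqon (hn _ ni).
  rewrite (inv_prod m unit_y) -(big_nats m (fun i => (1 - y i)^-1)).
  apply: (prod_eqon cM (sub _ (leq_maxr _ _))) => i.
  rewrite in_fset /= mem_iota /= add0n -leqNgt => ni; exact: inv_y_eqon (hm _ ni).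
have e2 : fps_eqon (divides M) (infprod factor2)
    (\prod_(i < n) \prod_(j < m) (1 - x i * y j) / \prod_(i < n) c i).
  apply: (fps_eqon_trans (infprod_eqon factor2_hu (A := box n m) _)).
    move=> p /notin_box [np|mp]; first by apply: factor2_eqon; left; apply: hn.
    by apply: factor2_eqon; right; apply: hm.
  rewrite big_box (inv_prod n unit_c) -big_split /=.
  rewrite (eq_bigr (fun i : 'I_n => \prod_(j < m) (1 - x i * y j) / c i)) => [|i _].
    exact: fps_eqon_refl.
  by rewrite /c (inv_prod m (unit_xy i)) -big_split.
apply: (fps_eqon_trans (fps_eqonM cM e1 e2)).
rewrite phi_num phi_den.
have ua : \prod_(i < n) (1 - x i) \is a GRing.unit by apply: unit_prod => i; apply: unit_x.
have ub : \prod_(j < m) (1 - y j) \is a GRing.unit by apply: unit_prod => i; apply: unit_y.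
have uc : \prod_(i < n) c i \is a GRing.unit by apply: unit_prod => i; apply: unit_c.
move: ua ub uc.
move: (\prod_(i < n) (1 - x i)) (\prod_(j < m) (1 - y j)) (\prod_(i < n) c i)
  (\prod_(i < n) \prod_(j < m) (1 - x i * y j)) => a b d N ua ub ud.
have uab : a * b \is a GRing.unit by rewrite unitrM ua ub.
rewrite (invrM uab ud) (invrM ua ub) [d^-1 * _]mulrC [b^-1 * _]mulrC mulrCA.
exact: fps_eqon_refl.
Qed.

Lemma unit_phi_den : phi (box_den q n m) \is a GRing.unit.
Proof.
rewrite phi_den !unitrM; apply/andP; split; first (apply/andP; split).
- by apply: unit_prod => i; apply: unit_x.
- by apply: unit_prod => i; apply: unit_y.
by apply: unit_prod => i; apply: unit_c.
Qed.

Hypothesis q0 : q != 0.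

(** B is one more than the degree of M, so the truncation error does not reach the coefficient at
    M. *)
Lemma phi_box_sum M :
  (forall i, (n <= i)%N -> M (inl i) = 0%N) ->
  (forall j, (m <= j)%N -> M (inr j) = 0%N) ->
  coef (phi (box_sum q n m (monalg.mdeg M).+1)) M =
  coef (infprod factor1 * infprod factor2) M.
Proof.
move=> hn hm; set B := (monalg.mdeg M).+1.
rewrite (infprod_finite hn hm); last by exists mone; rewrite mulm1.
have MB : lowdeg B M by rewrite /lowdeg.
have defect : fps_ord B (phi (box_num F n m) - phi (box_den q n m) * phi (box_sum q n m B)).
  rewrite -rmorphM -rmorphB; apply: fps_ord_mpoly; exact: mord_box_defect.
(* Multiplying by the inverse of the denominator preserves the order, so the error of the quotient
   is also of order at least B. *)
have := fps_ordMl (phi (box_den q n m))^-1 defect MB.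
rewrite mulrBr (mulKr unit_phi_den) mulrC => /eqP.
by rewrite -[coef (_ - _) M]/(coef _ M - coef _ M) subr_eq0 => /eqP ->.
Qed.

Lemma coef_box_sum M B :
  coef (phi (box_sum q n m B)) M =
  \sum_(la <- box_shapes n B) \sum_(mu <- box_shapes m B)
    hl_weight q la mu *
    coef (fps_of_mpoly (fun i : 'I_n => inl (val i)) (hl_poly q n la) *
          fps_of_mpoly (fun j : 'I_m => inr (val j)) (hl_poly q m mu)) M.
Proof.
rewrite /box_sum rmorph_sum fps_coef_sum; apply: eq_bigr => la _.
rewrite rmorph_sum fps_coef_sum; apply: eq_bigr => mu _.
rewrite -[GRing.RMorphism.sort _ _]/(phi _) -mul_mpolyC 2!phiM.
rewrite /phi fps_of_mpolyC !fps_of_embed mulr_algl.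
have -> : (fun i => v (lshift m i)) = (fun i : 'I_n => inl (val i)).
  by apply: funext => i; rewrite v_l.
have -> : (fun j => v (rshift n j)) = (fun j : 'I_m => inr (val j)).
  by apply: funext => j; rewrite v_r.
reflexivity.
Qed.

End FiniteAlphabets.

(** Coefficientwise: partial sums over finite sets containing a suitable box have the coefficient at
    M of [box_sum], which is that of the product. *)
Lemma hl_sum_infprod : q != 0 ->
  has_sum (fun p : intpart * intpart => hl_weight q p.1 p.2 *:
      (fps_rename inl (hl q p.1) * fps_rename inr (hl q p.2)))
    (infprod factor1 * infprod factor2).
Proof.
move=> q0 M; have [mx [my eM]] := cmonom_split M.
set n := cmonom_bound mx; set m := cmonom_bound my; set B := (monalg.mdeg M).+1.
(* The box depends on M: lengths are bounded by the variables M involves, and parts by its degree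
   plus one. *)
pose A0 := [fset p | p in [seq (la, mu) | la <- box_shapes n B, mu <- box_shapes m B]]%fset.
exists A0 => A sA; rewrite fps_coef_sum.
have hn i : (n <= i)%N -> M (inl i) = 0%N.
  move=> ni; rewrite eM cmM cmonom_mapE ?(cmonom_bound_gt ni) ?cmonom_map_out // => a b [] //.
have hm j : (m <= j)%N -> M (inr j) = 0%N.
  move=> mj; rewrite eM cmM cmonom_map_out // cmonom_mapE ?(cmonom_bound_gt mj) // => a b [] //.
rewrite -(phi_box_sum q0 hn hm) coef_box_sum.
rewrite -(big_fset_incl _ sA) => [|p pA]; last first.
  move=> /negP pA0; rewrite -[LHS]/(_ * coef _ M) (@coef_hl_pair_eq0 F q p.1 p.2 M mx my eM) ?mulr0 //.
  move=> [p1 p2]; apply: pA0; rewrite in_fset.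
  by apply/allpairsP; exists p; split=> //; case: (p).
transitivity (\sum_(p <- [seq (la, mu) | la <- box_shapes n B, mu <- box_shapes m B])
   hl_weight q p.1 p.2 *
   coef (fps_rename inl (hl q p.1) * fps_rename inr (hl q p.2)) M).
  apply: perm_big; apply: uniq_perm; rewrite ?fset_uniq //.
    by rewrite allpairs_uniq ?undup_uniq // => -[a b] [c d].
  by move=> p; rewrite in_fset.
rewrite big_allpairs; apply: eq_bigr => la _; apply: eq_bigr => mu _.
by rewrite eM coef_hl_pair.
Qed.

End Product.

Theorem theorem1p1 (F : fieldType) (q : F) (hq : q != 0) :
  let x (i : nat) : fps (nat + nat)%type F := fps_var F (inl i) in
  let y (j : nat) : fps (nat + nat)%type F := fps_var F (inr j) in
  let Px (la : intpart) : fps (nat + nat)%type F := fps_rename inl (hl q la) in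
  let Py (mu : intpart) : fps (nat + nat)%type F := fps_rename inr (hl q mu) in
  let lhs_term (p : intpart * intpart) :=
    q ^ ((nstat p.1)%:Z + (nstat p.2)%:Z
         - (pairing (conj_part p.1) (conj_part p.2))%:Z)
      *: (Px p.1 * Py p.2) in
  let factor1 (i : nat) := 1 / ((1 - x i) * (1 - y i)) in
  let factor2 (p : nat * nat) :=
    (1 - x p.1 * y p.2) / (1 - q^-1 *: (x p.1 * y p.2)) in
  [/\ summable lhs_term,
      multipliable factor1,
      multipliable factor2
    & infsum lhs_term = infprod factor1 * infprod factor2].
Proof.
move=> x y Px Py lhs_term factor1 factor2.
have sum_lhs : has_sum lhs_term (infprod factor1 * infprod factor2) by apply: hl_sum_infprod.
have summable_lhs : summable lhs_term by eexists; exact: sum_lhs.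
split; [exact: summable_lhs|exact: multipliable_factor1|exact: multipliable_factor2|].
(* Limits are unique, and summability makes [infsum] a limit rather than its default. *)
apply: fset_cvg_unique sum_lhs.
exact: (@xgetPex _ 0 [set s | has_sum lhs_term s]%classic summable_lhs).
Qed.
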